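(* Let $X$ be a proper geodesic metric space with base point $\mathfrak{o}$. Then the $1$-Morse boundary $\partial_1 X$ and the contracting boundary $\partial_c X$ are equivalent as topological spaces: $\partial_1 X=\partial_c X$ as sets, and the topology on this set defined by the neighbourhoods $U_1(\mathbf{b},r)$ coincides with the topology defined by the neighbourhoods $U(\mathbf{b},r)$.
   Context: **Setting.** $(X,d)$ is a proper geodesic metric space with base point $\mathfrak{o}$; $\|p\|:=d(\mathfrak{o},p)$. For $q\ge 1$, $Q\ge 0$, a $(q,Q)$-quasi-geodesic is a $(q,Q)$-quasi-isometric embedding of an interval; all quasi-geodesics are taken continuous, and all quasi-geodesic rays are based at (start at) $\mathfrak{o}$. A quasi-geodesic is identified with its image when convenient. For a quasi-geodesic ray $\alpha$, let $t_r$ be the first time with $\|\alpha(t_r)\|=r$; write $\alpha_r:=\alpha(t_r)$ and $\alpha|_r:=\alpha([0,t_r])$. A sublinear function is an increasing (i.e. non-decreasing), concave function $\rho:[0,\infty)\to[1,\infty)$ with $\lim_{x\to\infty}\rho(x)/x=0$. **Contracting boundary as a set.** For a closed $Z\subset X$ let $\pi_Z:X\to 2^Z$ be closest point projection. $Z$ is $\rho$-contracting, for a sublinear function $\rho$, if for all $x,y\in X$, $d(x,y)\le d(x,Z)$ implies $\operatorname{diam}(\pi_Z(x)\cup\pi_Z(y))\le\rho(d(x,Z))$; $Z$ is contracting if it is $\rho$-contracting for some sublinear $\rho$. $\partial_c X$ is the set of equivalence classes of contracting quasi-geodesic rays based at $\mathfrak{o}$, two being equivalent if they are at bounded Hausdorff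 distance. **Topology on $\partial_c X$.** For sublinear $\rho$, $q\ge1$, $Q\ge0$ set $$\kappa(\rho,q,Q)=\max\{3Q,\ 3q^2,\ 1+\inf\{R>0 \mid \forall r\ge R,\ 3q^2\rho(r)<r\}\}.$$ For each $\mathbf{b}\in\partial_c X$ fix a geodesic ray $b\in\mathbf{b}$ based at $\mathfrak{o}$ and a sublinear function $\rho_b$ such that $b$ is $\rho_b$-contracting. For $r>0$, $U(\mathbf{b},r)$ is the set of $\mathbf{a}\in\partial_c X$ such that for all $q\ge1$, $Q\ge0$ and every continuous $(q,Q)$-quasi-geodesic ray $\alpha\in\mathbf{a}$, $$d(\alpha,\ b\cap\mathcal{N}_r^c\mathfrak{o})\le\kappa(\rho_b,q,Q),$$ where $\mathcal{N}_r^c\mathfrak{o}=\{p:\|p\|\ge r\}$ is the complement of the $r$-neighbourhood of $\mathfrak{o}$ and $d$ of two sets is the infimum of distances. A set $V\subset\partial_c X$ is open iff for every $\mathbf{b}\in V$ there is $r>0$ with $U(\mathbf{b},r)\subset V$. **$1$-Morse boundary as a set.** $\mathcal{N}(Z,m):=\{x\in X: d(x,Z)\le m\}$. A closed set $Z$ is $1$-Morse if there is a proper function $m_Z:[1,\infty)\times[0,\infty)\to\mathbb{R}$ (a Morse gauge), assumed to satisfy $m_Z(q,Q)\ge\max(q,Q)$, such that for any sublinear function $\kappa'$ and any $r>0$ there exists $R$ such that for any $(q,Q)$-quasi-geodesic ray $\beta$ with $m_Z(q,Q)\le r/2$: $d(\beta_R,Z)\le\kappa'(R)$ implies $\beta|_r\subset\mathcal{N}(Z,m_Z(q,Q))$.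 (For $Z$ a quasi-geodesic ray this is equivalent to the existence of a proper function $m_Z$ such that every $(q,Q)$-quasi-geodesic with endpoints on $Z$ lies in $\mathcal{N}(Z,m_Z(q,Q))$.) $\partial_1 X$ is the set of equivalence classes of $1$-Morse quasi-geodesic rays based at $\mathfrak{o}$, where $\alpha\sim\beta$ iff $\lim_{r\to\infty} d(\alpha_r,\beta_r)/r=0$. **Topology on $\partial_1 X$.** For each $\mathbf{b}\in\partial_1 X$ fix a $1$-Morse quasi-geodesic ray $\hat b\in\mathbf{b}$ with Morse gauge $m_{\hat b}$. For $r>0$, $U_1(\mathbf{b},r)$ is the set of $\mathbf{a}\in\partial_1 X$ such that for all $q\ge1$, $Q\ge0$ and every $(q,Q)$-quasi-geodesic ray $\alpha\in\mathbf{a}$, $m_{\hat b}(q,Q)\le r/2$ implies $\alpha|_r\subset\mathcal{N}(\hat b,m_{\hat b}(q,Q))$. A set $V\subset\partial_1 X$ is open iff for every $\mathbf{b}\in V$ there is $r>0$ with $U_1(\mathbf{b},r)\subset V$. *)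

(* Defs.v *)
From HB Require Import structures.
From mathcomp Require Import all_boot all_order all_algebra.
From mathcomp Require Import all_classical all_reals all_analysis.

Set Implicit Arguments.
Unset Strict Implicit.
Unset Printing Implicit Defensive.

Import Order.TTheory GRing.Theory Num.Theory.
Import numFieldNormedType.Exports.

Local Open Scope classical_set_scope.
Local Open Scope ring_scope.

Section Metric.
Context {R : realType} {X : metricType R}.
Implicit Types (x y : X) (A Z : set X).

Definition proper_space : Prop :=
  forall x (r : R), compact [set y | mdist x y <= r].

Definition geodesic_space : Prop :=
  forall x y, exists g : R -> X,
    [/\ g 0 = x, g (mdist x y) = y &
        {in `[0, mdist x y] &, forall s t, mdist (g s) (g t) = `|s - t|}].

(* Real infima: [dist_set] and [dist_sets] are meaningful for nonempty sets,
   the only ones to which they are applied below. *)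
Definition dist_set x Z : R := inf [set mdist x z | z in Z].

Definition dist_sets A Z : R :=
  inf [set mdist p.1 p.2 | p in A `*` Z].

Definition closed_nbhd Z (m : R) : set X := [set x | dist_set x Z <= m].

Definition diam A : \bar R :=
  ereal_sup [set (mdist p.1 p.2)%:E | p in A `*` A].

Definition closest_proj Z x : set X :=
  [set z | Z z /\ mdist x z = dist_set x Z].

Definition bounded_hausdorff A Z : Prop :=
  exists C : R, A `<=` closed_nbhd Z C /\ Z `<=` closed_nbhd A C.

End Metric.

(* Functions on [0, oo[ are represented by functions on R; their values at
   negative arguments are irrelevant. *)
Definition sublinear {R : realType} (rho : R -> R) : Prop :=
  [/\ forall x : R, 0 <= x -> 1 <= rho x,
      {in `[0, +oo[ &, {homo rho : x y / x <= y}},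
      forall x y t : R, 0 <= x -> 0 <= y -> 0 <= t <= 1 ->
        t * rho x + (1 - t) * rho y <= rho (t * x + (1 - t) * y) &
      rho x / x @[x --> +oo] --> (0 : R)].

Section Contracting.
Context {R : realType} {X : metricType R}.
Implicit Types (Z : set X) (rho : R -> R).

Definition contracting_with rho Z : Prop :=
  [/\ closed Z, sublinear rho &
      forall x y, mdist x y <= dist_set x Z ->
        (diam (closest_proj Z x `|` closest_proj Z y)
           <= (rho (dist_set x Z))%:E)%E].

Definition contracting Z : Prop := exists rho, contracting_with rho Z.

End Contracting.

Definition kappa {R : realType} (rho : R -> R) (q Q : R) : R :=
  Num.max (3 * Q) (Num.max (3 * q ^+ 2)
    (1 + inf [set S : R | 0 < S /\ forall r : R, S <= r -> 3 * q ^+ 2 * rho r < r])).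

(* Proper in the metric sense: preimages of bounded sets are bounded. The gauge
   is not assumed continuous. Only the values at q >= 1, Q >= 0 matter. *)
Definition proper_gauge {R : realType} (m : R -> R -> R) : Prop :=
  forall c : R, exists M : R, forall q Q, 1 <= q -> 0 <= Q ->
    `|m q Q| <= c -> q <= M /\ Q <= M.

(* The family of open sets on B generated by neighbourhoods U b r, r > 0. *)
Definition nbhd_topology {R : realType} {T : Type} (B : set T)
    (U : T -> R -> set T) : set (set T) :=
  [set V | V `<=` B /\ forall b, V b -> exists2 r, 0 < r & U b r `<=` V].

Section Boundaries.
Context {R : realType} {X : metricType R} (o : X).
Implicit Types (alpha beta : R -> X) (q Q r : R) (a b : set (R -> X)).
Implicit Types (Z : set X) (m : R -> R -> R).

Definition ray_image alpha : set X := alpha @` `[0, +oo[.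

Definition quasi_geodesic_ray q Q alpha : Prop :=
  [/\ 1 <= q, 0 <= Q, alpha 0 = o, {within `[0, +oo[, continuous alpha} &
      {in `[0, +oo[ &, forall s t,
        q^-1 * `|s - t| - Q <= mdist (alpha s) (alpha t) <= q * `|s - t| + Q}].

Definition geodesic_ray alpha : Prop :=
  alpha 0 = o /\
  {in `[0, +oo[ &, forall s t, mdist (alpha s) (alpha t) = `|s - t|}.

(* For a continuous unbounded ray from o and r >= 0 this infimum is attained. *)
Definition first_time alpha r : R :=
  inf [set t | 0 <= t /\ mdist o (alpha t) = r].

Definition ray_at alpha r : X := alpha (first_time alpha r).

Definition ray_upto alpha r : set X := alpha @` `[0, first_time alpha r].

(* Boundary points are literal equivalence classes, i.e. sets of rays. *)

Definition contracting_ray alpha : Prop :=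
  (exists q Q, quasi_geodesic_ray q Q alpha) /\ contracting (ray_image alpha).

Definition contracting_equiv alpha beta : Prop :=
  bounded_hausdorff (ray_image alpha) (ray_image beta).

Definition contracting_boundary : set (set (R -> X)) :=
  [set [set beta | contracting_ray beta /\ contracting_equiv alpha beta]
     | alpha in contracting_ray].

Definition morse_gauge m Z : Prop :=
  [/\ closed Z, proper_gauge m,
      forall q Q, 1 <= q -> 0 <= Q -> Num.max q Q <= m q Q &
      forall kappa' r, sublinear kappa' -> 0 < r ->
        exists2 S, 0 < S & forall q Q beta, quasi_geodesic_ray q Q beta ->
          m q Q <= r / 2 ->
          dist_set (ray_at beta S) Z <= kappa' S ->
          ray_upto beta r `<=` closed_nbhd Z (m q Q)].

Definition morse Z : Prop := exists m, morse_gauge m Z.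

Definition morse_ray alpha : Prop :=
  (exists q Q, quasi_geodesic_ray q Q alpha) /\ morse (ray_image alpha).

Definition morse_equiv alpha beta : Prop :=
  mdist (ray_at alpha r) (ray_at beta r) / r @[r --> +oo] --> (0 : R).

Definition morse_boundary : set (set (R -> X)) :=
  [set [set beta | morse_ray beta /\ morse_equiv alpha beta]
     | alpha in morse_ray].

Definition contracting_choice
    (gam : set (R -> X) -> R -> X) (rho : set (R -> X) -> R -> R) : Prop :=
  forall b, contracting_boundary b ->
    [/\ geodesic_ray (gam b), b (gam b) &
        contracting_with (rho b) (ray_image (gam b))].

Definition U_contracting gam rho b r : set (set (R -> X)) :=
  [set a | contracting_boundary a /\
     forall q Q alpha, a alpha -> quasi_geodesic_ray q Q alpha ->
       dist_sets (ray_image alpha)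
         (ray_image (gam b) `&` [set p | r <= mdist o p])
       <= kappa (rho b) q Q].

Definition contracting_topology gam rho : set (set (set (R -> X))) :=
  nbhd_topology contracting_boundary (U_contracting gam rho).

Definition morse_choice
    (gam : set (R -> X) -> R -> X) (mu : set (R -> X) -> R -> R -> R) : Prop :=
  forall b, morse_boundary b ->
    b (gam b) /\ morse_gauge (mu b) (ray_image (gam b)).

Definition U_morse gam mu b r : set (set (R -> X)) :=
  [set a | morse_boundary a /\
     forall q Q alpha, a alpha -> quasi_geodesic_ray q Q alpha ->
       mu b q Q <= r / 2 ->
       ray_upto alpha r `<=` closed_nbhd (ray_image (gam b)) (mu b q Q)].

Definition morse_topology gam mu : set (set (set (R -> X))) :=
  nbhd_topology morse_boundary (U_morse gam mu).

End Boundaries.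

(* Main.v *)
Require Import Defs.
From HB Require Import structures.
From mathcomp Require Import all_boot all_order all_algebra.
From mathcomp Require Import all_classical all_reals all_analysis.
From mathcomp Require Import ring lra.

Set Implicit Arguments.
Unset Strict Implicit.
Unset Printing Implicit Defensive.

Import Order.TTheory GRing.Theory Num.Theory.
Import numFieldNormedType.Exports.

Local Open Scope classical_set_scope.
Local Open Scope ring_scope.

(** For a quasi-geodesic ray, being contracting and being Morse is the same thing, for
    such rays the two equivalence relations are the same, and a neighbourhood of a boundary
    point of either kind contains one of the other kind. Write [Z] for the image of a ray.

    Contracting rays are Morse. As long as a quasi-geodesic stays at distance at least
    [kappa rho q Q] from [Z], its projection to [Z] moves at most at half the speed of the
    quasi-geodesic ([projection_slow]). So the time spent away from [Z] is linearly
    bounded by the distances to [Z] at both ends ([far_time_bound]). An excursion that comes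
    back is therefore short, and one that does not come back recedes linearly from [Z]
    ([excursion]), which is impossible for a ray at sublinear distance from [Z]
    ([sublinear_neighbour], [contracting_morse]).

    Morse rays are contracting. Suppose that [d(x, y) <= d(x, Z) / 2] while the projections
    [p], [p'] of [x], [y] satisfy [d(p, p') > e d(x, Z)]. Rising from [p] towards [x], crossing to the
    geodesic from [p'] to [y] at the first good opportunity and descending to [p'] is a
    quasi-geodesic with constants depending on [e] only ([hinge_path]). Substituted for
    the part of the ray between [p] and [p'], it gives a quasi-geodesic ray ([detour_ray])
    that ends in [Z]. The Morse property keeps that ray in a neighbourhood of [Z] of a
    size depending on [e] only ([morse_absorbs]), but it rises to height [d(p, p') / 3]. Hence
    [d(p, p') <= e d(x, Z) + C_e] in all cases ([hinge_bound]); a chain of such steps treats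
    [d(x, y) <= d(x, Z)] ([morse_projection_bound]), and the infimum over [e] of these affine
    bounds is a sublinear contraction function ([affine_bounds_sublinear]).

    Equivalence. Sublinear closeness of contracting rays implies uniform closeness by
    [sublinear_neighbour]. For the converse the points at the first time of norm [r] must be
    compared: on a contracting ray, points of equal norm are uniformly close
    ([contracting_norm_gap]).

    Topologies. Both kinds of neighbourhoods say that a ray passes close to a fixed ray
    far from the origin, up to constants. That closeness at one large radius propagates
    to smaller radii is again the bound on excursions ([U_contracting_small]), and going
    back to the last time of distance at most [kappa] turns closeness up to an arbitrary
    constant into closeness up to [kappa] ([U_morse_small]). *)

(** * Level crossings of continuous real functions *)

Section Crossings.
Context {R : realType}.
Implicit Types (f : R -> R) (a b c k : R).

Lemma ivt_le f a b k : a <= b -> {within `[a, b], continuous f} ->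
  f a <= k -> k <= f b -> exists c, [/\ a <= c, c <= b & f c = k].
Proof.
move=> ab cf fa fb.
have [|c] := @IVT R f a b k ab cf.
  by rewrite ge_min fa/= le_max fb orbT.
by rewrite in_itv/= => /andP[ac cb] fc; exists c.
Qed.

(** The crossing is at the supremum of the times at which [f <= k]. *)
Lemma last_crossing_lt f a b k : a <= b -> {within `[a, b], continuous f} ->
  f a <= k -> k <= f b ->
  exists c, [/\ a <= c, c <= b, f c = k & forall u, c < u -> u <= b -> k < f u].
Proof.
move=> ab cf fa fb.
pose A := [set c | a <= c <= b /\ f c <= k].
have Aa : A a by rewrite /A/= lexx ab.
have ubA : ubound A b by move=> c [/andP[]].
have hsA : has_sup A by split; [exists a|exists b].
set c := sup A.
have ac : a <= c by apply: ub_le_sup => //; exists b.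
have cb : c <= b by apply: sup_le_ub => //; exists a.
have above u : c < u -> u <= b -> k < f u.
  move=> cu ub; rewrite ltNge; apply/negP => fu.
  have : u <= c.
    apply: ub_le_sup; first by exists b.
    by split=> //; rewrite ub andbT (le_trans ac)// ltW.
  by rewrite leNgt cu.
have sub x y : a <= x -> y <= b -> {within `[x, y], continuous f}.
  move=> ax yb; apply: continuous_subspaceW cf => z /=.
  by rewrite !in_itv/= => /andP[xz zy]; rewrite (le_trans ax xz) (le_trans zy yb).
have fck : f c <= k.
  rewrite leNgt; apply/negP => fc.
  have cont_at_c : exists2 e, 0 < e & forall z, a <= z -> z <= b ->
      `|z - c| < e -> k < f z.
    have /subspace_continuousP/(_ c) := cf.
    rewrite /= in_itv/= ac cb => /(_ isT) /cvgrPdist_lt /(_ (f c - k)).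
    rewrite subr_gt0 => /(_ fc).
    rewrite near_withinE => /nbhs_ballP[e /= e0 He]; exists e => // z az zb ze.
    have := He z; rewrite /ball/= (distrC c z) => /(_ ze).
    rewrite in_itv/= az zb => /(_ isT).
    by rewrite /from_subspace ltr_norml => /andP[_ ?]; lra.
  have [e' e'0 He] := cont_at_c.
  have [z Az zc] := sup_adherent e'0 hsA.
  have [/andP[az zb] fz] := Az.
  have zc' : z <= c by apply: ub_le_sup => //; exists b.
  have := He z az zb; rewrite ler0_norm ?subr_le0// => kf.
  have : k < f z by apply: kf; rewrite /c; lra.
  by rewrite ltNge fz.
have fcE : f c = k.
  apply/eqP; rewrite eq_le fck/= leNgt; apply/negP => fc.
  have [d [cd db fd]] := ivt_le cb (sub _ _ ac (lexx _)) fck fb.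
  have cd' : c < d by rewrite lt_neqAle cd andbT; apply/eqP => E; subst d; lra.
  by have := above d cd' db; rewrite fd ltxx.
by exists c; split.
Qed.

Lemma last_crossing f a b k : a <= b -> {within `[a, b], continuous f} ->
  f a <= k -> k <= f b ->
  exists c, [/\ a <= c, c <= b, f c = k & forall u, c <= u -> u <= b -> k <= f u].
Proof.
move=> ab cf fa fb; have [c [ac cb fc H]] := last_crossing_lt ab cf fa fb.
exists c; split=> // u; rewrite le_eqVlt => /predU1P[<- _|cu ub].
  by rewrite fc.
exact/ltW/H.
Qed.

Lemma within_comp {T : topologicalType} (f : R -> T) (g : R -> R) (A B : set R) :
  {within B, continuous f} -> continuous g -> (forall t, A t -> B (g t)) ->
  {within A, continuous (f \o g)}.
Proof.
move=> /subspace_continuousP cf cg AB; apply/subspace_continuousP => t At.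
move=> U /(cf _ (AB _ At)) /(cg t) H.
have {}H : nbhs t (fun z => B (g z) -> U (f (g z))) := H.
change (nbhs t (fun z => A z -> U (f (g z)))).
by apply: filterS H => z Hz Az; exact/Hz/AB.
Qed.

Lemma first_crossing f a b k : a <= b -> {within `[a, b], continuous f} ->
  k <= f a -> f b <= k ->
  exists c, [/\ a <= c, c <= b, f c = k & forall u, a <= u -> u <= c -> k <= f u].
Proof.
move=> ab cf fa fb.
have [||||c [ac cb fc H]] := @last_crossing (f \o -%R) (- b) (- a) k.
- by rewrite lerN2.
- apply: within_comp cf _ _; first by move=> t; exact: continuousN.
  by move=> t /=; rewrite !in_itv/= => /andP[? ?]; apply/andP; split; lra.
- by rewrite /= opprK.
- by rewrite /= opprK.
exists (- c); split=> //; [lra|lra|].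
by move=> u au uc; have := H (- u); rewrite /= opprK; apply; lra.
Qed.

End Crossings.

(** * Distance to a set *)

Section Distance.
Context {R : realType} {X : metricType R}.
Implicit Types (x y z : X) (A Z : set X).

Lemma dist_set_has_lbound x Z : has_lbound [set mdist x z | z in Z].
Proof. by exists 0 => _ [z _ <-]; exact: mdist_ge0. Qed.

Lemma dist_set_le x Z z : Z z -> dist_set x Z <= mdist x z.
Proof.
by move=> Zz; apply: ge_inf; [exact: dist_set_has_lbound|exists z].
Qed.

Lemma dist_set_ge x Z (k : R) : Z !=set0 -> (forall z, Z z -> k <= mdist x z) ->
  k <= dist_set x Z.
Proof.
move=> [z Zz] H; apply: lb_le_inf; first by exists (mdist x z), z.
by move=> _ [w Zw <-]; exact: H.
Qed.

Lemma dist_set_ge0 x Z : Z !=set0 -> 0 <= dist_set x Z.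
Proof. by move=> Z0; apply: dist_set_ge => // z _; exact: mdist_ge0. Qed.

Lemma dist_set_approx x Z (e : R) : Z !=set0 -> 0 < e ->
  exists2 z, Z z & mdist x z < dist_set x Z + e.
Proof.
move=> [z Zz] e0.
have [||_ [w Zw <-] H] := @inf_adherent R [set mdist x z | z in Z] e => //.
  by split; [exists (mdist x z), z|exact: dist_set_has_lbound].
by exists w.
Qed.

Lemma dist_set_tri x y Z : Z !=set0 -> dist_set x Z <= mdist x y + dist_set y Z.
Proof.
move=> Z0; rewrite -lerBlDl; apply: dist_set_ge => // z Zz.
by have := dist_set_le x Zz; have := metric_triangle x y z; lra.
Qed.

Lemma lipschitz_within (B : set R) (b : R -> X) (f : X -> R) :
  (forall x y, f x <= mdist x y + f y) -> {within B, continuous b} ->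
  {within B, continuous (f \o b)}.
Proof.
move=> fL /subspace_continuousP cb; apply/subspace_continuousP => t Bt.
apply/cvgrPdist_lt => e e0.
have /metricType_numDomainType.cvgrPdist_lt/(_ e e0) := cb t Bt.
apply: filterS => s /= H.
move: H; rewrite /from_subspace /= ltr_norml => H.
have := fL (b t) (b s); have := fL (b s) (b t).
by rewrite (metric_sym (b s)) => ? ?; apply/andP; split; lra.
Qed.

Lemma dist_set_within (B : set R) (b : R -> X) Z : Z !=set0 ->
  {within B, continuous b} -> {within B, continuous (fun t => dist_set (b t) Z)}.
Proof.
by move=> Z0; apply: (@lipschitz_within B b (dist_set^~ Z)) => x y; exact: dist_set_tri.
Qed.

Lemma mdist_within (B : set R) (b : R -> X) x :
  {within B, continuous b} -> {within B, continuous (fun t => mdist x (b t))}.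
Proof.
apply: (@lipschitz_within B b (mdist x)) => y z.
by rewrite (metric_sym y) addrC; exact: metric_triangle.
Qed.

Lemma lipschitz1_within (B : set R) (b : R -> X) :
  {in B &, forall s t, mdist (b s) (b t) <= `|s - t|} -> {within B, continuous b}.
Proof.
move=> bL; apply/subspace_continuousP => t Bt.
apply/metricType_numDomainType.cvgrPdist_lt => e e0.
rewrite near_withinE; near=> s => Bs.
apply: (le_lt_trans (bL t s (mem_set Bt) (mem_set Bs))).
by near: s; exact: cvgr_dist_lt.
Unshelve. all: by end_near. Qed.

Lemma closest_point x Z : @proper_space R X -> closed Z -> Z !=set0 ->
  exists2 z, Z z & mdist x z = dist_set x Z.
Proof.
move=> Xp cZ Z0.
pose K := [set y | mdist x y <= dist_set x Z + 1] `&` Z.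
have cK : compact K by apply: compact_closedI => //; exact: Xp.
have [w Zw wlt] := dist_set_approx x Z0 (@ltr01 R).
have Kw : K w by split=> //; exact: ltW.
have [||c cK' cmin] := @compact_EVT_min X R (mdist x) K _ cK; first by exists w.
  apply: continuous_subspaceT => y; apply/cvgrPdist_lt => e e0.
  near=> z; have yz : mdist y z < e.
    by near: z; exact: metricType_numDomainType.cvgr_dist_lt.
  rewrite ltr_norml; have := metric_triangle x y z; have := metric_triangle x z y.
  by rewrite (metric_sym z) => ? ?; apply/andP; split; lra.
move: cK'; rewrite inE => -[/= cd Zc]; exists c => //.
apply/eqP; rewrite eq_le dist_set_le// andbT; apply: dist_set_ge => // z Zz.
have [zd|zd] := leP (mdist x z) (dist_set x Z + 1).
  by apply: cmin; rewrite inE; split.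
by apply: le_trans (ltW zd).
Unshelve. all: by end_near. Qed.

Lemma dist_set0 x Z : Z x -> dist_set x Z = 0.
Proof.
move=> Zx; apply/eqP; rewrite eq_le dist_set_ge0 ?andbT; last by exists x.
by rewrite -(mdistxx x); exact: dist_set_le.
Qed.

End Distance.

(** * Sublinear functions and the constant kappa *)

Section Sublinear.
Context {R : realType}.
Implicit Types (f rho : R -> R).

(** The convergences to 0 of [rho x / x] and of [d(a_r, b_r) / r] are only ever used,
    and proved, through these linear bounds. *)
Lemma ratio_cvg0P f : (forall x, 0 <= x -> 0 <= f x) ->
  (f x / x @[x --> +oo] --> (0 : R)) <->
  (forall e, 0 < e -> exists2 M, 0 < M & forall x, M <= x -> f x <= e * x).
Proof.
move=> f0; split=> [fx e e0|H].
  have /cvgrPdist_le/(_ e e0)[M [_ HM]] := fx.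
  exists (Num.max 1 (M + 1)); first by rewrite lt_max ltr01.
  move=> x; rewrite ge_max => /andP[x1 xM].
  have x0 : 0 < x by lra.
  have := HM x ltac:(lra); rewrite sub0r normrN ger0_norm; last first.
    by rewrite divr_ge0 ?f0//; lra.
  by rewrite ler_pdivrMr.
apply/cvgrPdist_le => e e0; have [M M0 HM] := H e e0.
exists M; split; first exact: num_real.
move=> x Mx; have x0 : 0 < x by lra.
rewrite sub0r normrN ger0_norm; last by rewrite divr_ge0 ?f0//; lra.
by rewrite ler_pdivrMr// HM// ltW.
Qed.

Lemma sublinear_small rho : sublinear rho -> forall e, 0 < e ->
  exists2 M, 0 < M & forall x, M <= x -> rho x <= e * x.
Proof.
move=> [rho1 _ _ rho0] e e0.
have /ratio_cvg0P H : forall x, 0 <= x -> 0 <= Num.max 0 (rho x).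
  by move=> x x0; rewrite le_max lexx.
have /H/(_ e e0)[M M0 HM] : Num.max 0 (rho x) / x @[x --> +oo] --> (0 : R).
  apply: cvg_trans rho0; apply: near_eq_cvg; near=> x.
  have x0 : 0 <= x by near: x; exact: nbhs_pinfty_ge.
  by rewrite max_r// (le_trans _ (rho1 x x0)).
exists M => // x Mx; apply: le_trans (HM x Mx); by rewrite le_max lexx orbT.
Unshelve. all: by end_near. Qed.

Lemma sublinear_cst (C : R) : 1 <= C -> sublinear (fun=> C).
Proof.
move=> C1; split=> //.
- by move=> x y t _ _ _; rewrite -mulrDl addrC subrK mul1r.
- apply/ratio_cvg0P => [x _|e e0]; first by lra.
  exists (C / e); first by rewrite divr_gt0//; lra.
  by move=> x; rewrite ler_pdivrMr// mulrC.
Qed.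

Lemma kappa_ge rho (q Q : R) : 3 * Q <= kappa rho q Q /\ 3 * q ^+ 2 <= kappa rho q Q.
Proof. by rewrite /kappa !le_max !lexx orbT. Qed.

Lemma kappa_ge3 rho (q Q : R) : 1 <= q -> 3 <= kappa rho q Q.
Proof. by move=> q1; have [_] := kappa_ge rho q Q; nra. Qed.

(** The summand 1 in [kappa] puts it strictly above the infimum, so that the
    defining inequality of that infimum holds from [kappa] on. *)
Lemma kappa_spec rho (q Q r : R) : sublinear rho -> 1 <= q ->
  kappa rho q Q <= r -> 3 * q ^+ 2 * rho r < r.
Proof.
move=> srho q1.
pose E := [set S : R | 0 < S /\ forall r : R, S <= r -> 3 * q ^+ 2 * rho r < r].
have q2 : 1 <= q ^+ 2 by rewrite expr_ge1//; lra.
have hiE : has_inf E.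
  split; last by exists 0 => S [/ltW].
  have e0 : 0 < (6 * q ^+ 2)^-1 by rewrite invr_gt0; lra.
  have [M M0 HM] := sublinear_small srho e0; exists M; split=> // s Ms.
  have := HM s Ms; rewrite mulrC ler_pdivlMr; [nra|lra].
have [S [S0 HS] Slt] := inf_adherent ltr01 hiE.
rewrite {1}/kappa !ge_max => /andP[_ /andP[_ H]].
by apply: HS; move: H Slt; rewrite -/E; lra.
Qed.

End Sublinear.

(** * Quasi-geodesics far from a contracting set *)

Section QuasiPaths.
Context {R : realType} {X : metricType R}.
Implicit Types (b : R -> X) (q Q s t u : R) (Z : set X).

(** The lower bound is written without division, which suits linear
    arithmetic; it says that [(t - s) / q - Q] is at most the distance. *)
Definition quasi_path q Q s0 t0 b : Prop :=
  [/\ 1 <= q, 0 <= Q, {within `[s0, t0], continuous b} &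
   forall s t, s0 <= s -> s <= t -> t <= t0 ->
     t - s <= q * (mdist (b s) (b t) + Q) /\
     mdist (b s) (b t) <= q * (t - s) + Q].

Lemma sub_quasi_path q Q s0 t0 s t b : quasi_path q Q s0 t0 b ->
  s0 <= s -> t <= t0 -> quasi_path q Q s t b.
Proof.
move=> [q1 Q0 cb H] ss tt; split=> //.
  apply: continuous_subspaceW cb => z /=; rewrite !in_itv/= => /andP[? ?].
  by apply/andP; split; lra.
by move=> u v su uv vt; apply: H => //; lra.
Qed.

Lemma contracting_step rho Z x y p p' : contracting_with rho Z ->
  mdist x y <= dist_set x Z -> closest_proj Z x p -> closest_proj Z y p' ->
  mdist p p' <= rho (dist_set x Z).
Proof.
move=> [_ _ H] /H xy px py; rewrite -lee_fin; apply: le_trans xy.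
by apply: ereal_sup_ubound; exists (p, p') => //=; split; [left|right].
Qed.

Section Contracted.
Context (Xproper : @proper_space R X).
Context (rho : R -> R) (Z : set X) (q Q : R).
Context (crho : contracting_with rho Z) (Z0 : Z !=set0).
Let kap := kappa rho q Q.

Lemma closest_proj_ex x : exists p, closest_proj Z x p.
Proof.
have [cZ _ _] := crho.
by have [p Zp dp] := closest_point x Xproper cZ Z0; exists p.
Qed.

(** In the last step of [projection_slow], [d] bounds the displacement of the
    projection, [r] is the value of [rho] at [D], [D] and [E] are the distances to [Z] at the two ends, [F] is the
    distance between the ends and [l] the time elapsed. *)
Lemma last_piece_arith (d r D E F l : R) : 1 <= q -> 0 <= l ->
  d <= r -> 3 * q ^+ 2 * r < D -> D <= F + E -> F <= q * l + Q -> 3 * Q <= E ->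
  3 <= E -> 2 * q * d <= l + q * E.
Proof.
move=> q1 l0 dr rD DFE Fl QE E3.
have q2 : 1 <= q ^+ 2 by rewrite expr_ge1//; lra.
have H : 3 * q ^+ 2 * d <= 4 / 3 * E + q * l by nra.
rewrite -(ler_pM2l (_ : 0 < 3 * q)); last by lra.
have : q * l >= 0 by nra.
have : q ^+ 2 * E >= E by nra.
nra.
Qed.

(** While a quasi-geodesic is at distance at least [kappa] from [Z], its
    projection moves at speed at most [1 / (2 q)], half of the least speed of the
    quasi-geodesic itself. Indeed, cut the path into pieces such that the
    distance [d] between the ends of a piece is the distance from its start to [Z]: by contraction the projection of a
    piece has diameter at most [rho d < d / (3 q ^ 2)], whereas the piece takes at
    least the time [2 d / (3 q)], because [Q <= d / 3]. The last piece is shorter and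
    is paid for by the term in the distance from [b t] to [Z]. *)
Lemma projection_slow b s t p p' : quasi_path q Q s t b -> s <= t ->
  (forall u, s <= u -> u <= t -> kap <= dist_set (b u) Z) ->
  closest_proj Z (b s) p -> closest_proj Z (b t) p' ->
  2 * q * mdist p p' <= (t - s) + q * dist_set (b t) Z.
Proof.
move=> bq st far pp pp'.
have [q1 Q0 _ _] := bq; have [_ srho _] := crho.
have [kQ _] := kappa_ge rho q Q; have k3 := kappa_ge3 rho Q q1.
rewrite -/kap in kQ k3.
(* Every full piece lasts at least [2 / q], so the number of pieces is bounded. *)
have [n] : exists n : nat, q * (t - s) <= n%:R.
  exists (Num.truncn (q * (t - s))).+1; apply/ltW; exact: truncnS_gt.
elim: n s st bq far p pp => [|n IH] s st bq far p pp nst.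
all: have [_ _ cb bqq] := bq; have dk := far s (lexx _) st;
  have rk := kappa_spec srho q1 dk; have tk := far t st (lexx _).
all: have [le|gt] := leP (mdist (b s) (b t)) (dist_set (b s) Z).
1,3: have pr := contracting_step crho le pp pp';
  have [_ up] := bqq s t (lexx _) st (lexx _);
  have tri := dist_set_tri (b s) (b t) Z0;
  by apply: (last_piece_arith q1 _ pr rk tri up); lra.
- have e : t = s by nra.
  by move: gt; rewrite e mdistxx; lra.
have [u [su ut du]] : exists u, [/\ s <= u, u <= t & mdist (b s) (b u) = dist_set (b s) Z].
  apply: ivt_le => //; [exact: mdist_within|by rewrite mdistxx; lra|exact: ltW].
have [pu ppu] := closest_proj_ex (b u).
have pr : mdist p pu <= rho (dist_set (b s) Z).
  by apply: (contracting_step crho _ pp ppu); rewrite du.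
have [_ up] := bqq s u (lexx _) su ut; rewrite du in up.
have far' v : u <= v -> v <= t -> kap <= dist_set (b v) Z.
  by move=> uv vt; apply: far => //; lra.
have := IH u ut (sub_quasi_path bq su (lexx _)) far' pu ppu.
have /[swap]/[apply] : q * (t - u) <= n%:R by rewrite -natr1 in nst; nra.
have := metric_triangle p pu p'.
move=> tri ih; suff : 2 * q * mdist p pu <= u - s by nra.
rewrite -(ler_pM2l (_ : 0 < 3 * q)); last by lra.
have q2 : 0 <= q ^+ 2 by rewrite exprn_ge0//; lra.
have : 3 * q ^+ 2 * mdist p pu <= 3 * q ^+ 2 * rho (dist_set (b s) Z) by nra.
move: up rk kQ dk; clear -q1 Q0 su; nra.
Qed.

(** The endpoints are at most as far apart as the sum of their distances to [Z]
    and of the displacement of the projection; since the latter grows at half the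
    speed of [b], the time elapsed is bounded by the distances to [Z] at the ends. *)
Lemma far_time_bound b s t : quasi_path q Q s t b -> s <= t ->
  (forall u, s <= u -> u <= t -> kap <= dist_set (b u) Z) ->
  t - s <= 2 * q * (dist_set (b s) Z + 3 / 2 * dist_set (b t) Z + Q).
Proof.
move=> bq st far; have [p pp] := closest_proj_ex (b s).
have [p' pp'] := closest_proj_ex (b t).
have := projection_slow bq st far pp pp'.
have [q1 Q0 _ bqq] := bq; have [lo _] := bqq s t (lexx _) st (lexx _).
case: pp pp' => [_ <-] [_ <-].
have := metric_triangle (b s) p (b t); have := metric_triangle p p' (b t).
rewrite (metric_sym p'); move: lo; clear -q1 Q0; nra.
Qed.

(** Let [s] be the last time before [u] at which [b] is at distance [kappa] from
    [Z]. If [b] comes back to this distance between [u] and [T], then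
    [far_time_bound] bounds the duration of the whole excursion; otherwise it bounds
    [T - s]. *)
Lemma excursion b T u : quasi_path q Q 0 T b -> Z (b 0) -> 0 <= u -> u <= T ->
  dist_set (b u) Z <= kap + q * (2 * q * (5 / 2 * kap + Q)) + Q \/
  exists s, [/\ 0 <= s, s <= u, dist_set (b s) Z = kap &
    T - s <= 2 * q * (kap + 3 / 2 * dist_set (b T) Z + Q)].
Proof.
move=> bq Zb u0 uT; have [q1 Q0 _ bqq] := bq.
have k3 := kappa_ge3 rho Q q1; rewrite -/kap in k3.
have cf t0 t1 : 0 <= t0 -> t1 <= T ->
    {within `[t0, t1], continuous (fun t => dist_set (b t) Z)}.
  by move=> ? ?; apply: dist_set_within => //; have [] := sub_quasi_path bq (s := t0) (t := t1).
have [near|far] := leP (dist_set (b u) Z) kap.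
  left; apply: (le_trans near); nra.
have [s [s0 su ds fars]] : exists s, [/\ 0 <= s, s <= u, dist_set (b s) Z = kap &
    forall v, s <= v -> v <= u -> kap <= dist_set (b v) Z].
  by apply: last_crossing => //; [exact: cf|rewrite dist_set0//; lra|exact: ltW].
have [[v [uv vT dv]]|nret] := pselect (exists v, [/\ u <= v, v <= T & dist_set (b v) Z <= kap]).
  left.
  have [t [ut tv dt fart]] : exists t, [/\ u <= t, t <= v, dist_set (b t) Z = kap &
      forall w, u <= w -> w <= t -> kap <= dist_set (b w) Z].
    by apply: first_crossing => //; [apply: cf; lra|exact: ltW].
  have bq' : quasi_path q Q s t b by apply: sub_quasi_path bq _ _ => //; lra.
  have st : s <= t by lra.
  have far' w : s <= w -> w <= t -> kap <= dist_set (b w) Z.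
    by move=> sw wt; have [/fars|/ltW/fart] := leP w u; apply.
  have := far_time_bound bq' st far'; rewrite ds dt.
  have [_ up] := bqq s u s0 su ltac:(lra).
  have := dist_set_tri (b u) (b s) Z0; rewrite ds (metric_sym (b u)).
  by move: up; clear -q1 Q0 ut; nra.
right; exists s; split=> //; rewrite -ds.
apply: far_time_bound; [exact: sub_quasi_path bq _ _|lra|].
move=> w sw wT; have [/fars|uw] := leP w u; first exact.
by rewrite leNgt; apply/negP => /ltW H; apply: nret; exists w; split=> //; exact: ltW.
Qed.

End Contracted.
End QuasiPaths.

(** * Quasi-geodesic rays *)

Section Rays.
Context {R : realType} {X : metricType R} (o : X).
Implicit Types (b : R -> X) (q Q s t u r : R) (Z : set X).

Lemma ray_pathP q Q b : quasi_geodesic_ray o q Q b <->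
  b 0 = o /\ forall T, 0 <= T -> quasi_path q Q 0 T b.
Proof.
split=> [[q1 Q0 b0 cb H]|[b0 H]].
  have qp : 0 < q by lra.
  split=> // T T0; split=> //.
    apply: continuous_subspaceW cb => z /=; rewrite !in_itv/= => /andP[z0 _].
    by rewrite z0.
  move=> s t s0 st tT.
  have /andP[lo up] : q^-1 * `|s - t| - Q <= mdist (b s) (b t) <= q * `|s - t| + Q.
    by apply: H; rewrite in_itv/= andbT; lra.
  move: lo up; rewrite distrC ger0_norm ?subr_ge0// => lo up; split=> //.
  by rewrite -ler_pdivrMl//; lra.
have [q1 Q0 _ _] := H 0 (lexx _); have qp : 0 < q by lra.
split=> //.
  apply/subspace_continuousP => t /=; rewrite in_itv/= andbT => t0.
  have [_ _ /subspace_continuousP/(_ t) + _] := H (t + 1) ltac:(lra).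
  rewrite /= in_itv/= t0 lerDl ler01 => /(_ isT) ct.
  apply: cvg_trans ct => U /= HU.
  have {}HU : nbhs t (fun z => z \in `[0, t + 1] -> U (b z)) := HU.
  change (nbhs t (fun z => z \in `[0, +oo[ -> U (b z))).
  have tt : nbhs t (fun z => z <= t + 1).
    by apply: filterS (lt_nbhsl (_ : t < t + 1)) => [z|]; [exact: ltW|lra].
  apply: filterS2 HU tt => z Hz zt; rewrite in_itv/= andbT => z0.
  by apply: Hz; rewrite in_itv/= z0.
have lo s t : 0 <= s -> s <= t ->
    q^-1 * `|s - t| - Q <= mdist (b s) (b t) <= q * `|s - t| + Q.
  move=> s0 st; have [_ _ _ /(_ s t s0 st (lexx _))[l u]] := H t ltac:(lra).
  rewrite distrC ger0_norm ?subr_ge0// u andbT lerBlDr.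
  by rewrite ler_pdivrMl.
move=> s t; rewrite !in_itv/= !andbT => s0 t0.
have [st|ts] := leP s t; first exact: lo.
by rewrite distrC metric_sym; apply: lo => //; exact: ltW.
Qed.

Lemma ray_path q Q b T : quasi_geodesic_ray o q Q b -> 0 <= T -> quasi_path q Q 0 T b.
Proof. by move=> /ray_pathP[_]; apply. Qed.

Lemma ray_imageP b t : 0 <= t -> ray_image b (b t).
Proof. by move=> t0; exists t => //=; rewrite in_itv/= t0. Qed.

Lemma ray_image0 b : ray_image b !=set0.
Proof. by exists (b 0); exact: ray_imageP. Qed.

Lemma ray_image_origin q Q b : quasi_geodesic_ray o q Q b -> ray_image b o.
Proof. by move=> /ray_pathP[<- _]; exact: ray_imageP. Qed.

Lemma ray_norm_le q Q b t : quasi_geodesic_ray o q Q b -> 0 <= t ->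
  mdist o (b t) <= q * t + Q.
Proof.
move=> bq t0; have [b0 _] := (ray_pathP q Q b).1 bq.
have [_ _ _ /(_ 0 t (lexx _) t0 (lexx _))[_]] := ray_path bq t0.
by rewrite b0 subr0.
Qed.

Lemma ray_norm_ge q Q b t : quasi_geodesic_ray o q Q b -> 0 <= t ->
  t <= q * (mdist o (b t) + Q).
Proof.
move=> bq t0; have [b0 _] := (ray_pathP q Q b).1 bq.
have [_ _ _ /(_ 0 t (lexx _) t0 (lexx _))[+ _]] := ray_path bq t0.
by rewrite b0 subr0.
Qed.

(** The infimum defining [first_time] is attained; this yields its two useful
    properties, that the ray stays in the ball of radius [r] before it and that it
    precedes every time at which the ray is outside this ball. *)
Lemma first_timeP q Q b r : quasi_geodesic_ray o q Q b -> 0 <= r ->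
  [/\ 0 <= first_time o b r, mdist o (ray_at o b r) = r,
      forall t, 0 <= t -> t <= first_time o b r -> mdist o (b t) <= r &
      forall t, 0 <= t -> r <= mdist o (b t) -> first_time o b r <= t].
Proof.
move=> bq r0; have [q1 Q0 b0 _ _] := bq.
have first t : 0 <= t -> r <= mdist o (b t) -> exists c, [/\ 0 <= c, c <= t,
    mdist o (b c) = r & forall u, 0 <= u -> u < c -> mdist o (b u) < r].
  move=> t0 rt; have [_ _ cb _] := ray_path bq t0.
  have [||||c [c0 ct ec H]] :=
    @last_crossing_lt R ((fun t => - mdist o (b t)) \o -%R) (- t) 0 (- r).
  - lra.
  - apply: (@within_comp _ _ (fun t => - mdist o (b t)) _ _ `[0, t]).
    + apply: (@lipschitz_within _ _ _ _ (fun x => - mdist o x)) cb => x y.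
      by have := metric_triangle o x y; lra.
    + by move=> z; exact: continuousN.
    + by move=> z /=; rewrite !in_itv/= => /andP[? ?]; apply/andP; split; lra.
  - by rewrite /= opprK; lra.
  - by rewrite /= oppr0 b0 mdistxx; lra.
  exists (- c); move: ec => /= ec; split=> //; [lra|lra|lra|].
  by move=> u u0 uc; have := H (- u); rewrite /= opprK; lra.
have [c [c0 _ ec H]] : exists c, [/\ 0 <= c, c <= q * (r + Q),
    mdist o (b c) = r & forall u, 0 <= u -> u < c -> mdist o (b u) < r].
  have t0 : 0 <= q * (r + Q) by apply: mulr_ge0; lra.
  apply: first => //; have := ray_norm_ge bq t0.
  by rewrite ler_pM2l ?lerD2r//; lra.
have ftE : first_time o b r = c.
  apply/eqP; rewrite eq_le; apply/andP; split.
    by apply: ge_inf => //; exists 0 => t [].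
  apply: lb_le_inf; first by exists c.
  move=> t [t0 et]; rewrite leNgt; apply/negP => /(H t t0).
  by rewrite et ltxx.
rewrite /ray_at ftE.
split=> // t t0; first by rewrite le_eqVlt => /predU1P[->|/(H t t0)/ltW//]; rewrite ec.
move=> rt; rewrite leNgt; apply/negP => /(H t t0); lra.
Qed.

Section Contracting.
Context (Xproper : @proper_space R X).
Context (rho : R -> R) (Z : set X) (crho : contracting_with rho Z) (Zo : Z o).

Let Z0 : Z !=set0. Proof. by exists o. Qed.

(** How far an excursion that has come back can go, as in [excursion]. *)
Definition contracting_gauge (rho : R -> R) q Q : R :=
  kappa rho q Q + q * (2 * q * (5 / 2 * kappa rho q Q + Q)) + Q.

Lemma kappa_le_gauge (rho' : R -> R) q Q : 1 <= q -> 0 <= Q ->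
  kappa rho' q Q <= contracting_gauge rho' q Q.
Proof.
move=> q1 Q0; have k3 := kappa_ge3 rho' Q q1; rewrite /contracting_gauge.
have : 0 <= q * (2 * q * (5 / 2 * kappa rho' q Q + Q)).
  by rewrite !mulr_ge0//; lra.
lra.
Qed.

Lemma ray_near_contracting q Q b T u : quasi_geodesic_ray o q Q b ->
  0 <= u -> u <= T ->
  dist_set (b u) Z <= contracting_gauge rho q Q \/
  exists s, [/\ 0 <= s, s <= u, dist_set (b s) Z = kappa rho q Q &
    T - s <= 2 * q * (kappa rho q Q + 3 / 2 * dist_set (b T) Z + Q)].
Proof.
move=> bq u0 uT; have [b0 _] := (ray_pathP q Q b).1 bq.
by apply: (excursion Xproper crho Z0 (ray_path bq _)) => //; [lra|rewrite b0].
Qed.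

(** An excursion that never ends would, by [excursion], force the distance to [Z] at
    radius [r] to be at least linear in [r]. *)
Lemma sublinear_neighbour q Q b : quasi_geodesic_ray o q Q b ->
  (forall e, 0 < e -> exists2 M, 0 < M & forall r, M <= r ->
     dist_set (ray_at o b r) Z <= e * r) ->
  forall u, 0 <= u -> dist_set (b u) Z <= contracting_gauge rho q Q.
Proof.
move=> bq close u u0; have [q1 Q0 _ _ _] := bq.
have k3 := kappa_ge3 rho Q q1; set k := kappa rho q Q in k3 *.
have qq : 0 < 6 * q ^+ 2 by rewrite mulr_gt0// exprn_gt0//; lra.
have e0 : 0 < (6 * q ^+ 2)^-1 by rewrite invr_gt0.
have [M M0 HM] := close _ e0.
(* [c] collects the terms that do not depend on the radius; an excursion still going
   on at radius [r] would give [r <= c + 3 q ^ 2 d] with [d <= r / (6 q ^ 2)]. *)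
pose c := q * u + Q + 2 * q ^+ 2 * (k + Q) + Q.
pose r := Num.max M (2 * c + 1).
have rM : M <= r by rewrite le_max lexx.
have rc : 2 * c + 1 <= r by rewrite le_max lexx orbT.
have c0 : q * u + Q <= c.
  rewrite /c; have : 0 <= 2 * q ^+ 2 * (k + Q) by rewrite !mulr_ge0// ?exprn_ge0//; lra.
  lra.
have qu : 0 <= q * u by rewrite mulr_ge0//; lra.
have [ft0 ftr _ ftmin] := first_timeP bq (ltac:(lra) : 0 <= r).
have uT : u <= first_time o b r.
  rewrite leNgt; apply/negP => /ltW ltu.
  have := ray_norm_le bq ft0; rewrite ftr.
  have : q * first_time o b r <= q * u by rewrite ler_pM2l//; lra.
  lra.
have [//|[s [s0 su ds sT]]] := ray_near_contracting bq u0 uT.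
have sr := HM r rM; rewrite ler_pdivlMl// in sr.
have := ray_norm_le bq s0.
have [_ _ _ /(_ s (first_time o b r) s0 ltac:(lra) (lexx _))[_ up]] := ray_path bq ft0.
have := metric_triangle o (b s) (ray_at o b r); rewrite ftr.
move: up sr sT rc; rewrite /ray_at /c -/k; set F := first_time o b r.
set D := dist_set _ Z; set d := mdist (b s) _ => up sr sT rc tri sn.
have : q * (F - s) <= 2 * q ^+ 2 * (k + Q) + 3 * q ^+ 2 * D by nra.
have : q * s <= q * u by nra.
nra.
Qed.

(** As for [sublinear_neighbour], with a radius that has to be uniform over all
    [q] and [Q]: the bound [m q Q <= r / 2] makes [q], [Q] and [kappa] smaller than [r],
    and the excursion starts inside the ball of radius [r]. *)
Lemma contracting_morse : morse_gauge o (contracting_gauge rho) Z.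
Proof.
have [cZ srho _] := crho; split=> //.
- move=> c; exists c => q Q q1 Q0.
  have := kappa_le_gauge rho q1 Q0; have [] := kappa_ge rho q Q.
  move=> k1 k2 k3 /(le_trans (ler_norm _)) gc.
  have : q <= q ^+ 2 by rewrite ler_eXnr.
  by split; nra.
- move=> q Q q1 Q0.
  have := kappa_le_gauge rho q1 Q0; have [] := kappa_ge rho q Q.
  have : q <= q ^+ 2 by rewrite ler_eXnr.
  by rewrite /Num.max; case: ifP => _ *; nra.
move=> kappa' r skappa' r0.
have rr : 0 < (r + 1) ^+ 2 by rewrite exprn_gt0//; lra.
have q20 : 0 < 2 * (3 * (r + 1) ^+ 2) by lra.
have e0 : 0 < (2 * (3 * (r + 1) ^+ 2))^-1 by rewrite invr_gt0.
have [M M0 HM] := sublinear_small skappa' e0.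
pose c := r + 2 * (r + 1) ^+ 2 * (2 * r) + r.
exists (Num.max M (2 * c + 1)); first by rewrite lt_max M0.
move=> q Q b bq gr bS x [u + <-]; rewrite /= in_itv/= => /andP[u0 ur].
have [q1 Q0 _ _ _] := bq.
have kg := kappa_le_gauge rho q1 Q0; have [kQ kq] := kappa_ge rho q Q.
have qq2 : q <= q ^+ 2 by rewrite ler_eXnr.
have k3 := kappa_ge3 rho Q q1.
set k := kappa rho q Q in kg kQ kq k3.
set S := Num.max _ _ in bS.
have SM : M <= S by rewrite le_max lexx.
have Sc : 2 * c + 1 <= S by rewrite le_max lexx orbT.
have rc : r <= c.
  rewrite /c; have : 0 <= 2 * (r + 1) ^+ 2 * (2 * r) by rewrite !mulr_ge0// ?exprn_ge0//; lra.
  lra.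
have [ft0 ftS _ _] := first_timeP bq (ltac:(lra) : 0 <= S).
have [fr0 _ frle frmin] := first_timeP bq (ltW r0).
have uT : u <= first_time o b S.
  by apply: (le_trans ur); apply: frmin => //; rewrite -/(ray_at o b S) ftS; lra.
have [//|[s [s0 su ds sT]]] := ray_near_contracting bq u0 uT.
have sS := le_trans bS (HM S SM); rewrite ler_pdivlMl// in sS.
have sn := frle s s0 ltac:(lra).
have [_ _ _ /(_ s (first_time o b S) s0 ltac:(lra) (lexx _))[_ up]] := ray_path bq ft0.
have := metric_triangle o (b s) (ray_at o b S); rewrite ftS.
move: up sS sT Sc; rewrite /ray_at /c -/k; set F := first_time o b S.
have D0 : 0 <= dist_set (b F) Z by apply: dist_set_ge0.
move: D0; set D := dist_set _ Z; set d := mdist (b s) _ => D0 up sS sT Sc tri.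
have qr : q ^+ 2 <= (r + 1) ^+ 2 by rewrite lerXn2r// ?nnegrE; lra.
have : q * (F - s) <= 2 * q ^+ 2 * (k + Q) + 3 * q ^+ 2 * D by nra.
have : q ^+ 2 * D <= (r + 1) ^+ 2 * D by rewrite ler_wpM2r.
have : q ^+ 2 * (k + Q) <= (r + 1) ^+ 2 * (2 * r) by apply: ler_pM; rewrite ?exprn_ge0//; lra.
lra.
Qed.

End Contracting.
End Rays.

(** * Sublinear functions from affine bounds *)

Section Envelope.
Context {R : realType}.

(** The infimum of increasing affine functions is nondecreasing and concave; it
    is sublinear because slopes arbitrarily close to 0 occur. This replaces the optimal
    bound on a quantity, which need not be concave, by an admissible one. *)
Lemma affine_bounds_sublinear (A : R -> R -> Prop) :
  (forall e, 0 < e -> exists2 C, 0 <= C & A e C) ->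
  exists2 rho, sublinear rho & forall x d, 0 <= x ->
    (forall e C, 0 < e -> 0 <= C -> A e C -> d <= e * x + C) -> d <= rho x.
Proof.
move=> Aex.
pose B x := [set p.1 * x + p.2 | p in [set p : R * R | [/\ 0 < p.1, 0 <= p.2 & A p.1 p.2]]].
have [C1 C10 AC1] := Aex 1 ltr01.
have B0 x : B x !=set0 by exists (1 * x + C1), (1, C1).
have Bge x d : (forall e C, 0 < e -> 0 <= C -> A e C -> d <= e * x + C) -> d <= inf (B x).
  by move=> H; apply: lb_le_inf => // _ [[e C] /= [e0 C0 AeC] <-]; exact: H.
have Ble x e C : 0 <= x -> 0 < e -> 0 <= C -> A e C -> inf (B x) <= e * x + C.
  move=> x0 e0 C0 AeC; apply: ge_inf; last by exists (e, C).
  exists 0 => _ [[e' C'] /= [e'0 C'0 _] <-].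
  by rewrite addr_ge0// mulr_ge0// ltW.
have B_ge0 x : 0 <= x -> 0 <= inf (B x).
  by move=> x0; apply: Bge => e C e0 C0 _; rewrite addr_ge0// mulr_ge0// ltW.
exists (fun x => 1 + inf (B x)); last first.
  by move=> x d x0 H; rewrite -[d]add0r lerD// Bge.
split.
- by move=> x x0; have := B_ge0 x x0; lra.
- move=> x y; rewrite !in_itv/= !andbT => x0 y0 xy.
  rewrite lerD2l; apply: Bge => e C e0 C0 AeC.
  by apply: (le_trans (Ble x e C x0 e0 C0 AeC)); nra.
- move=> x y t x0 y0 /andP[t0 t1].
  suff : t * inf (B x) + (1 - t) * inf (B y) <= inf (B (t * x + (1 - t) * y)) by lra.
  apply: Bge => e C e0 C0 AeC.
  have := Ble x e C x0 e0 C0 AeC; have := Ble y e C y0 e0 C0 AeC; nra.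
apply/ratio_cvg0P => [x x0|e e0]; first by have := B_ge0 x x0; lra.
have e2 : 0 < e / 2 by lra.
have [C C0 AeC] := Aex _ e2.
exists (2 * (C + 1) / e); first by rewrite divr_gt0//; lra.
move=> x; rewrite ler_pdivrMr// => Cx.
have x0 : 0 <= x by nra.
by have := Ble x _ C x0 e2 C0 AeC; nra.
Qed.

End Envelope.

(** * Continuity of pasted paths *)

Section Pasting.
Context {R : realType}.

Lemma paste_within {T : topologicalType} (f g : R -> T) (a c d : R) :
  {within `[a, c], continuous f} -> {within `[c, d], continuous g} -> f c = g c ->
  {within `[a, d], continuous (fun u => if u <= c then f u else g u)}.
Proof.
move=> cf cg fg.
have AB : `[a, d]%classic `<=` `[a, c]%classic `|` `[c, d]%classic.
  move=> u /=; rewrite !in_itv/= => /andP[au ud].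
  by have [uc|cu] := leP u c; [left; rewrite au|right; rewrite ltW].
apply: continuous_subspaceW AB _.
apply: withinU_continuous; [exact: itv_closed|exact: itv_closed| |].
- apply: subspace_eq_continuous cf => u.
  by rewrite inE /= in_itv => /andP[_ /= uc]; rewrite /from_subspace /= uc.
- apply: subspace_eq_continuous cg => u.
  rewrite inE /= in_itv => /andP[/= cu _]; rewrite /from_subspace /=; case: leP => // uc.
  by have -> : u = c by apply/eqP; rewrite eq_le uc cu.
Qed.

Lemma lipschitz_real_within (B : set R) (f : R -> R) (k : R) : 0 < k ->
  (forall s t, B s -> B t -> s <= t -> `|f s - f t| <= k * (t - s)) ->
  {within B, continuous f}.
Proof.
move=> k0 fL; apply/subspace_continuousP => t Bt; apply/cvgrPdist_lt => e e0.
rewrite near_withinE; near=> s => Bs.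
have : `|t - s| < e / k by near: s; apply: cvgr_dist_lt => //; rewrite divr_gt0.
rewrite ltr_pdivlMr// mulrC; apply: le_lt_trans; rewrite /from_subspace.
have [ts|/ltW st] := leP t s.
  by rewrite [`|t - s|]distrC (ger0_norm (_ : 0 <= s - t)) ?subr_ge0// fL.
by rewrite distrC (ger0_norm (_ : 0 <= t - s)) ?subr_ge0// fL.
Unshelve. all: by end_near. Qed.

End Pasting.

(** * Rerouting a ray through a detour *)

Definition bilipschitz_path {R : realType} {X : metricType R} (k l : R)
    (f : R -> X) : Prop :=
  forall s t, 0 <= s -> s <= t -> t <= l ->
    mdist (f s) (f t) <= t - s /\ t - s <= k * mdist (f s) (f t).

Section Detour.
Context {R : realType} {X : metricType R} (o : X).
Implicit Types (alpha b : R -> X) (q Q s t u r : R) (Z : set X).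

(** In the Morse property the distance bound at radius [S] is tested against a
    sublinear function chosen beforehand: the constant function equal to a bound on
    the distance from [b] to [Z] makes the test succeed at every [S]. *)
Lemma morse_absorbs m Z q Q b (C : R) : morse_gauge o m Z ->
  quasi_geodesic_ray o q Q b -> (forall t, 0 <= t -> dist_set (b t) Z <= C) ->
  forall t, 0 <= t -> dist_set (b t) Z <= m q Q.
Proof.
move=> [_ _ mge mM] bq bC t t0; have [q1 Q0 _ _ _] := bq.
have qt : 0 <= q * t by rewrite mulr_ge0//; lra.
(* Large enough for the ray not to have reached radius [r] by time [t]. *)
pose r := q * t + Q + 1 + Num.max 0 (2 * m q Q).
have m1 : 0 <= Num.max 0 (2 * m q Q) by rewrite le_max lexx.
have m2 : 2 * m q Q <= Num.max 0 (2 * m q Q) by rewrite le_max lexx orbT.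
have r0 : 0 < r by rewrite /r; lra.
have C1 : 1 <= Num.max 1 C by rewrite le_max lexx.
have [S S0 HS] := mM _ r (sublinear_cst C1) r0.
have [fS0 _ _ _] := first_timeP bq (ltW S0).
have [fr0 er _ _] := first_timeP bq (ltW r0).
apply: (HS q Q b bq); first by rewrite ler_pdivlMr// /r; lra.
  by apply: (le_trans (bC _ fS0)); rewrite le_max lexx orbT.
exists t => //=; rewrite in_itv/= t0 /= leNgt; apply/negP => /ltW ft.
have := ray_norm_le bq fr0; rewrite -/(ray_at o b r) er /r.
have : q * first_time o b r <= q * t by rewrite ler_pM2l//; lra.
rewrite /r; lra.
Qed.

(** Here [D] is the distance of two points of the rerouted ray, [N] the time between
    them; with [E = q (4 D + Q)], a bound [E + K (q E + Q)] on [N] is what all the cases of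
    [detour_ray] give. *)
Lemma detour_lower_arith q K Q D N : 1 <= q -> 0 <= Q -> 1 <= K -> 0 <= D ->
  N <= q * (4 * D + Q) + K * (q * (q * (4 * D + Q)) + Q) ->
  N <= 4 * q * (1 + K * q) * (D + (q * Q * (1 + K * q) + K * Q)).
Proof.
move=> q1 Q0 K1 D0; have Kq : 1 <= K * q by apply: mulr_ege1.
set W := q * Q * (1 + K * q) + K * Q.
have W0 : 0 <= W by rewrite /W addr_ge0// !mulr_ge0//; lra.
have c1 : 1 <= 4 * q * (1 + K * q) by apply: mulr_ege1; lra.
have : W <= 4 * q * (1 + K * q) * W by rewrite ler_peMl.
move=> WW NW; apply: (le_trans NW).
have -> : q * (4 * D + Q) + K * (q * (q * (4 * D + Q)) + Q) =
    4 * q * (1 + K * q) * D + W by rewrite /W; ring.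
by rewrite [leRHS]mulrDr lerD2l.
Qed.

Lemma detour_upper_arith q K Q D N : 1 <= q -> 0 <= Q -> 1 <= K -> 0 <= N ->
  D <= q * N + 2 * Q ->
  D <= 4 * q * (1 + K * q) * N + (q * Q * (1 + K * q) + K * Q).
Proof.
move=> q1 Q0 K1 N0; have Kq : 1 <= K * q by apply: mulr_ege1.
have : 2 * Q <= q * Q * (1 + K * q).
  by rewrite mulrC; apply: ler_pM => //; [rewrite ler_peMl|lra].
have : 0 <= K * Q by rewrite mulr_ge0//; lra.
have : q * N <= 4 * q * (1 + K * q) * N.
  rewrite ler_wpM2r// mulrAC ler_peMl//; lra.
lra.
Qed.

(** The point of [G] at time [x] is at distance at least a third of [x] or of
    [L - x] from [alpha]. In the first case, a point of [alpha] at distance [D] from it is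
    at distance at most [4 D] from [alpha s], in the second case from [alpha t]; so the
    time separating them on [alpha] is controlled by [D], and with it the duration [L] of
    the detour, because [G] is bi-Lipschitz and joins [alpha s] to [alpha t]. Hence the
    rerouted ray cannot make the distance small without the elapsed time being small. *)
Lemma detour_ray q Q K alpha s t (G : R -> X) L :
  quasi_geodesic_ray o q Q alpha -> 0 <= s -> s <= t -> 0 <= L -> 1 <= K ->
  G 0 = alpha s -> G L = alpha t ->
  bilipschitz_path K L G ->
  (forall x z, 0 <= x -> x <= L -> ray_image alpha z ->
     x <= 3 * mdist (G x) z \/ L - x <= 3 * mdist (G x) z) ->
  exists b, [/\ quasi_geodesic_ray o (4 * q * (1 + K * q))
                  (q * Q * (1 + K * q) + K * Q) b,
    forall x, 0 <= x -> x <= L -> exists2 u, 0 <= u & b u = G x &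
    forall u, 0 <= u -> dist_set (b u) (ray_image alpha) <= L].
Proof.
move=> aq s0 st L0 K1 G0 GL GK Gaway.
have [q1 Q0 a0 _ _] := aq.
have aE x y : 0 <= x -> x <= y -> y - x <= q * (mdist (alpha x) (alpha y) + Q) /\
    mdist (alpha x) (alpha y) <= q * (y - x) + Q.
  move=> x0 xy; have [_ _ _ H] := ray_path aq (le_trans x0 xy); exact: H.
pose g2 u := if u <= s + L then G (u - s) else alpha (u - s - L + t).
pose b u := if u <= s then alpha u else g2 u.
have b1 u : u <= s -> b u = alpha u by rewrite /b => ->.
have b2 x : 0 <= x -> x <= L -> b (s + x) = G x.
  move=> x0 xL; rewrite /b /g2; case: leP => xs.
    have -> : x = 0 by lra.
    by rewrite addr0 G0.
  by rewrite lerD2l xL addrC addKr.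
have b3 w : t <= w -> b (w - t + s + L) = alpha w.
  move=> tw; rewrite /b /g2; case: leP => xs.
    have e : w - t + s + L = s by lra.
    have L00 : L = 0 by lra.
    have tw' : t = w by lra.
    by rewrite e -G0 -tw' -GL L00.
  case: leP => xL; last by congr alpha; ring.
  have -> : w = t by lra.
  by rewrite -GL; congr G; lra.
have cases u : 0 <= u -> [\/ 0 <= u <= s /\ b u = alpha u,
     exists x, [/\ s < u, 0 <= x, x <= L, u = s + x & b u = G x] |
     exists w, [/\ s + L < u, t <= w, u = w - t + s + L & b u = alpha w]].
  move=> u0; have [us|su] := leP u s.
    by apply: Or31; split; [rewrite u0|exact: b1].
  have [uL|Lu] := leP u (s + L).
    apply: Or32; exists (u - s); split; [lra|lra|lra|lra|].
    by rewrite -b2; [congr b; ring|lra|lra].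
  apply: Or33; exists (u - s - L + t); split; [lra|lra|lra|].
  by rewrite -b3; [congr b; ring|lra].
have LE : L <= K * (q * (t - s) + Q).
  have [_ H] := GK 0 L (lexx _) L0 (lexx _); rewrite subr0 G0 GL in H.
  apply: (le_trans H); rewrite ler_pM2l; last by lra.
  by have [] := aE s t s0 st.
have L4 x y D : 0 <= x -> x <= y -> mdist (alpha x) (alpha y) <= 4 * D ->
    y - x <= q * (4 * D + Q).
  move=> x0 xy H; have [H1 _] := aE x y x0 xy; apply: (le_trans H1).
  by rewrite ler_pM2l ?lerD2r//; lra.
have LE4 D : t - s <= q * (4 * D + Q) -> L <= K * (q * (q * (4 * D + Q)) + Q).
  move=> H; apply: (le_trans LE); rewrite ler_pM2l ?lerD2r ?ler_pM2l//; lra.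
have big D : 0 <= D -> [/\ 4 * D <= q * (4 * D + Q),
    q * (4 * D + Q) <= K * (q * (q * (4 * D + Q)) + Q) &
    K * D <= K * (q * (q * (4 * D + Q)) + Q)].
  move=> D0; have h1 : 4 * D <= q * (4 * D + Q) by nra.
  have h2 : q * (4 * D + Q) <= q * (q * (4 * D + Q)) by rewrite ler_peMl//; lra.
  by split=> //; [rewrite (le_trans h2)//; nra|rewrite ler_pM2l; lra].
exists b; split; last first.
- move=> u /cases[[/andP[u0 us] ->]|[x [_ x0 xL _ ->]]|[w [_ tw _ ->]]].
  + by rewrite dist_set0//; exact: ray_imageP.
  + have := dist_set_le (G x) (ray_imageP alpha s0); rewrite -G0 metric_sym.
    by have [H _] := GK 0 x (lexx _) x0 xL; lra.
  + by rewrite dist_set0//; apply: ray_imageP; lra.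
- by move=> x x0 xL; exists (s + x); [lra|rewrite b2].
apply/ray_pathP; split; first by rewrite b1.
have Kq : 1 <= K * q by apply: mulr_ege1.
move=> T T0; split.
- by apply: mulr_ege1; lra.
- by rewrite addr_ge0// !mulr_ge0//; lra.
- apply: paste_within.
  + by have [_ _] := ray_path aq s0.
  + apply: paste_within.
    * apply: (@within_comp _ _ G (fun u => u - s) _ `[0, L]).
      - apply: lipschitz1_within => x y; rewrite !inE/= !in_itv/= => /andP[x0 xL] /andP[y0 yL].
        have [xy|/ltW yx] := leP x y.
          by rewrite distrC ger0_norm ?subr_ge0//; have [] := GK x y x0 xy yL.
        by rewrite ger0_norm ?subr_ge0// metric_sym; have [] := GK y x y0 yx xL.
      - by move=> u; apply: cvgB; [exact: cvg_id|exact: cvg_cst].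
      - by move=> u /=; rewrite !in_itv/= => /andP[? ?]; apply/andP; split; lra.
    * apply: (@within_comp _ _ alpha (fun u => u - s - L + t) _ `[0, T + t]).
      - by have [_ _] := ray_path aq (ltac:(lra) : 0 <= T + t).
      - move=> u; apply: cvgD; last exact: cvg_cst.
        by apply: cvgB; [apply: cvgB; [exact: cvg_id|exact: cvg_cst]|exact: cvg_cst].
      - by move=> u /=; rewrite !in_itv/= => /andP[? ?]; apply/andP; split; lra.
    * by rewrite (_ : s + L - s = L) 1?GL; [congr alpha|]; ring.
  + by rewrite /g2 lerDl L0 subrr G0.
have Gup x y : 0 <= x -> x <= y -> y <= L -> mdist (G x) (G y) <= q * (y - x).
  move=> x0 xy yL; have [H _] := GK x y x0 xy yL; nra.
move=> u v u0 uv _; have v0 : 0 <= v by lra.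
set D := mdist (b u) (b v).
have D0 : 0 <= D by exact: mdist_ge0.
suff [lo up] : v - u <= q * (4 * D + Q) + K * (q * (q * (4 * D + Q)) + Q) /\
     D <= q * (v - u) + 2 * Q.
  split; first exact: detour_lower_arith.
  by apply: detour_upper_arith => //; lra.
have [B1 B2 B3] := big D D0; have {}LE4 := @LE4 D; have {}L4 x y := @L4 x y D.
(* [E] bounds time differences along [alpha], [F] the duration of the detour. The cases
   below are linear in them. *)
move: L4 LE4 B1 B2 B3; set E := q * (4 * D + Q); set F := K * _.
move: E F => E F L4 LE4 B1 B2 B3; move: D0 B1 B3 L4; rewrite {}/D.
clear big b1 b2 b3 LE; have t0 : 0 <= t := le_trans s0 st.
have [[/andP[_ us] ->]|[x [su x0 xL eu ->]]|[w [su tw eu ->]]] := cases u u0;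
have [[/andP[_ vs] ->]|[y [sv y0 yL ev ->]]|[z [sv tz ev ->]]] := cases v v0;
clear cases b g2 aq a0 T T0 Kq v0; set D := mdist _ _ => D0 B1 B3 L4.
- have [H1 H2] := aE u v u0 uv; rewrite -/D in H1 H2.
  have := L4 u v u0 uv ltac:(rewrite -/D; lra); lra.
- have [H1 H2] := aE u s u0 us; have H3 := Gup 0 y (lexx _) y0 yL.
  have tri := metric_triangle (alpha u) (alpha s) (G y).
  rewrite subr0 G0 in H3; rewrite -/D in tri; split; last by rewrite ev; lra.
  have [yD|yD] := Gaway y (alpha u) y0 yL (ray_imageP _ u0); rewrite metric_sym -/D in yD.
    have Gy : mdist (G y) (alpha s) <= y.
      by rewrite -G0 metric_sym; have [] := GK 0 y (lexx _) y0 yL; lra.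
    have tri2 := metric_triangle (alpha u) (G y) (alpha s); rewrite -/D in tri2.
    have := L4 u s u0 us ltac:(lra); lra.
  have Gy : mdist (G y) (alpha t) <= L - y.
    by rewrite -GL; have [] := GK y L y0 yL (lexx _).
  have tri2 := metric_triangle (alpha u) (G y) (alpha t); rewrite -/D in tri2.
  have H4 := L4 u t u0 (le_trans us st) ltac:(lra).
  have := LE4 ltac:(lra); lra.
- have H4 := L4 u z u0 (le_trans us (le_trans st tz)) ltac:(rewrite -/D; lra).
  have H5 := LE4 ltac:(lra); split; first by lra.
  have [_ H1] := aE u s u0 us; have [_ H2] := aE t z t0 tz.
  have H3 := Gup 0 L (lexx _) L0 (lexx _); rewrite G0 GL in H3.
  have := metric_triangle (alpha u) (alpha s) (alpha z).
  have := metric_triangle (alpha s) (alpha t) (alpha z); rewrite -/D.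
  by rewrite ev => *; lra.
- by exfalso; lra.
- have [H1 H2] := GK x y x0 ltac:(lra) yL; rewrite -/D in H1 H2.
  have H3 := Gup x y x0 ltac:(lra) yL; rewrite -/D in H3.
  by split; [lra|rewrite eu ev; lra].
- have z0 : 0 <= z := le_trans t0 tz.
  have H3 := Gup x L x0 xL (lexx _); rewrite GL in H3.
  have [_ H1] := aE t z t0 tz.
  have tri := metric_triangle (G x) (alpha t) (alpha z); rewrite -/D in tri.
  split; last by rewrite eu ev; lra.
  have [xD|xD] := Gaway x (alpha z) x0 xL (ray_imageP _ z0); rewrite -/D in xD.
    have Gx : mdist (alpha s) (G x) <= x.
      by rewrite -G0; have [] := GK 0 x (lexx _) x0 xL; lra.
    have tri2 := metric_triangle (alpha s) (G x) (alpha z); rewrite -/D in tri2.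
    have H4 := L4 s z s0 (le_trans st tz) ltac:(lra).
    have := LE4 ltac:(lra); lra.
  have Gx : mdist (alpha t) (G x) <= L - x.
    by rewrite -GL metric_sym; have [] := GK x L x0 xL (lexx _).
  have tri2 := metric_triangle (alpha t) (G x) (alpha z); rewrite -/D in tri2.
  have := L4 t z t0 tz ltac:(lra); lra.
- by exfalso; lra.
- by exfalso; lra.
- have [H1 H2] := aE w z ltac:(lra) ltac:(lra); rewrite -/D in H1 H2.
  have := L4 w z ltac:(lra) ltac:(lra) ltac:(rewrite -/D; lra) => H3.
  by split; [lra|rewrite eu ev; lra].
Qed.

End Detour.

(** * Detours built from two geodesics and a bar *)

Section Hinge.
Context {R : realType} {X : metricType R}.
Context (Xproper : @proper_space R X) (Xgeodesic : @geodesic_space R X).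
Implicit Types (Z : set X) (x y z p : X).

Definition isometric_path (l : R) (g : R -> X) : Prop :=
  forall s t, 0 <= s -> s <= t -> t <= l -> mdist (g s) (g t) = t - s.

Lemma isometric_bilipschitz (k l : R) (g : R -> X) : 1 <= k -> isometric_path l g -> bilipschitz_path k l g.
Proof.
move=> k1 gi s t s0 st tl; rewrite gi//; split=> //.
by rewrite ler_peMl// subr_ge0.
Qed.

Lemma isometric_within l g : isometric_path l g -> {within `[0, l], continuous g}.
Proof.
move=> gi; apply: lipschitz1_within => s t.
rewrite !inE/= !in_itv/= => /andP[s0 sl] /andP[t0 tl].
have [st|/ltW ts] := leP s t; first by rewrite gi// distrC ger0_norm ?subr_ge0.
by rewrite metric_sym gi// ger0_norm ?subr_ge0.
Qed.

Lemma geodesic_ex x y : exists g : R -> X, [/\ g 0 = x, g (mdist x y) = y &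
  isometric_path (mdist x y) g].
Proof.
have [g [g0 g1 gi]] := Xgeodesic x y; exists g; split=> // s t s0 st td.
rewrite gi ?in_itv/= ?s0 ?td ?andbT//; [|lra..].
by rewrite distrC ger0_norm// subr_ge0.
Qed.

(** A point of [Z] closer than [s] to [g s] would be closer to [x] than [p]. *)
Lemma closest_along_geodesic Z x p (g : R -> X) : closest_proj Z x p ->
  g 0 = p -> g (mdist p x) = x -> isometric_path (mdist p x) g ->
  forall s z, 0 <= s -> s <= mdist p x -> Z z -> s <= mdist (g s) z.
Proof.
move=> [Zp dp] g0 g1 gi s z s0 sd Zz.
have := dist_set_le x Zz; rewrite -dp => H.
have := metric_triangle x (g s) z; have := gi s (mdist p x) s0 sd (lexx _).
by rewrite g1 (metric_sym x (g s)); rewrite (metric_sym x p) in H; lra.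
Qed.

(** The first zero of the distance to [V] minus [s / 2]. Before it the geodesic
    recedes from [V] at linear speed. *)
Lemma first_half_close (V : set X) (g : R -> X) (l : R) : 0 <= l -> V !=set0 ->
  isometric_path l g -> dist_set (g l) V <= l / 2 ->
  exists a, [/\ 0 <= a, a <= l, dist_set (g a) V = a / 2 &
    forall s, 0 <= s -> s <= a -> s / 2 <= dist_set (g s) V].
Proof.
move=> l0 V0 gi gl.
have [||||a [a0 al ea H]] := @first_crossing R (fun s => dist_set (g s) V - s / 2) 0 l 0.
- by [].
- apply: (@lipschitz_real_within _ _ _ 2) => // s t.
  rewrite /= !in_itv/= => /andP[s0 _] /andP[_ tl] st.
  have := dist_set_tri (g s) (g t) V0; have := dist_set_tri (g t) (g s) V0.
  rewrite (metric_sym (g t)) (gi s t s0 st tl) => ? ?.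
  by rewrite ler_norml; apply/andP; split; lra.
- by have := dist_set_ge0 (g 0) V0; lra.
- by lra.
exists a; split=> //; first by lra.
by move=> s s0 sa; have := H s s0 sa; lra.
Qed.

Definition cat_path (a : R) (f g : R -> X) (u : R) : X :=
  if u <= a then f u else g (u - a).

Lemma cat_path_left a f g u : u <= a -> cat_path a f g u = f u.
Proof. by rewrite /cat_path => ->. Qed.

Lemma cat_path_right a f g u : f a = g 0 -> 0 <= u -> cat_path a f g (a + u) = g u.
Proof.
move=> fg u0; rewrite /cat_path; case: leP => [ua|_].
  have -> : u = 0 by lra.
  by rewrite addr0.
by rewrite addrC addKr.
Qed.

Lemma bilipschitz_cat (k a b : R) (f g : R -> X) : 1 <= k -> 0 <= a -> 0 <= b -> f a = g 0 ->
  bilipschitz_path k a f -> bilipschitz_path k b g ->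
  (forall s t, 0 <= s -> s <= a -> 0 <= t -> t <= b ->
     a - s + t <= k * mdist (f s) (g t)) ->
  bilipschitz_path k (a + b) (cat_path a f g).
Proof.
move=> k1 a0 b0 fg fk gk fgk s t s0 st tab.
have [ta|ta] := leP t a.
  by rewrite !cat_path_left//; [exact: fk|exact: le_trans ta].
have [sa|sa] := leP s a; last first.
  have -> : t = a + (t - a) by ring.
  have -> : s = a + (s - a) by ring.
  rewrite !cat_path_right//; [|lra..].
  rewrite (_ : a + (t - a) - (a + (s - a)) = t - a - (s - a)); last by ring.
  by apply: gk; lra.
have ct : cat_path a f g (a + (t - a)) = g (t - a).
  by apply: cat_path_right => //; lra.
rewrite (_ : a + (t - a) = t) in ct; last by ring.
rewrite (cat_path_left _ _ sa) ct.
have [H1 _] := fk s a s0 sa (lexx _).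
have [H2 _] := gk 0 (t - a) (lexx _) ltac:(lra) ltac:(lra).
have := fgk s (t - a) s0 sa ltac:(lra) ltac:(lra).
have := metric_triangle (f s) (f a) (g (t - a)); rewrite {2}fg.
by split; lra.
Qed.

(** The second application of [bilipschitz_cat] compares a point of [gu] with one of
    [gv]: there the time between them is simply bounded by the whole length. *)
Lemma three_sides_path (k a w b : R) (gu gw gv : R -> X) : 1 <= k -> 0 <= a -> 0 <= w -> 0 <= b ->
  gu a = gw 0 -> gw w = gv 0 ->
  isometric_path a gu -> isometric_path w gw -> isometric_path b gv ->
  (forall s t, 0 <= s -> s <= a -> 0 <= t -> t <= w ->
     a - s + t <= k * mdist (gu s) (gw t)) ->
  (forall s t, 0 <= s -> s <= w -> 0 <= t -> t <= b ->
     w - s + t <= k * mdist (gw s) (gv t)) ->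
  (forall s t, 0 <= s -> s <= a -> 0 <= t -> t <= b ->
     a + w + b <= k * mdist (gu s) (gv t)) ->
  exists G, [/\ bilipschitz_path k (a + w + b) G,
    forall s, s <= a -> G s = gu s,
    forall s, 0 <= s -> s <= w -> G (a + s) = gw s &
    forall s, 0 <= s -> G (a + w + s) = gv s].
Proof.
move=> k1 a0 w0 b0 uw wv gui gwi gvi UW WV UV.
have aw0 : 0 <= a + w by lra.
pose H := cat_path a gu gw.
have Hv : H (a + w) = gv 0 by rewrite /H cat_path_right.
exists (cat_path (a + w) H gv); split.
- apply: bilipschitz_cat => //; last 1 first.
  + move=> s t s0 sa t0 tb; have [sa'|sa'] := leP s a.
      rewrite /H cat_path_left//; apply: le_trans (UV s t s0 sa' t0 tb).
      by clear -s0 tb; lra.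
    have {1}-> : s = a + (s - a) by ring.
    rewrite /H (_ : s = a + (s - a)) ?cat_path_right//; [|by lra|by ring].
    have s1 : 0 <= s - a by clear -sa'; lra.
    have s2 : s - a <= w by clear -sa; lra.
    by apply: le_trans (WV _ t s1 s2 t0 tb); clear; lra.
  + by apply: bilipschitz_cat => //; exact: isometric_bilipschitz.
  + exact: isometric_bilipschitz.
- move=> s sa; have saw : s <= a + w by lra.
  by rewrite cat_path_left// /H cat_path_left.
- move=> s s0 sw; have asw : a + s <= a + w by lra.
  by rewrite cat_path_left//; exact: cat_path_right.
- by move=> s s0; rewrite cat_path_right.
Qed.

(** Go up the geodesic [gu] from [p] to [x] until the first point [u = gu a] that is
    half as far from the geodesic [gv] from [p'] to [y] as from [p], cross to the closest
    point [v] of [gv], and come down to [p']. The crossing makes no small angle with [gu]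
    because [u] is first, nor with [gv] because [v] is closest. The two vertical sides
    are at distance at least [P / 6] where [P = d(p, p')], and all lengths are at most
    [3 l] with [l = d(x, Z) <= P / e]; so the constants depend on [e] only. The vertical
    sides leave [Z] at unit speed, and the crossing is too short to come near [Z]. *)
Lemma hinge_path Z x y p p' (e : R) : 0 < e -> e <= 1 ->
  closest_proj Z x p -> closest_proj Z y p' ->
  mdist x y <= dist_set x Z / 2 -> e * dist_set x Z < mdist p p' ->
  exists (L : R) (G : R -> X), [/\ 0 <= L, G 0 = p, G L = p' &
   [/\ bilipschitz_path (18 / e) L G,
      forall s z, 0 <= s -> s <= L -> Z z ->
       s <= 3 * mdist (G s) z \/ L - s <= 3 * mdist (G s) z &
      exists2 s, 0 <= s <= L & mdist p p' <= 3 * dist_set (G s) Z]].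
Proof.
move=> e0 e1 xp yp' xy eP.
have [Zp dp] := xp; have [Zp' dp'] := yp'.
have Z0 : Z !=set0 by exists p.
have [gu [gu0 gu1 gui]] := geodesic_ex p x.
have [gv [gv0 gv1 gvi]] := geodesic_ex p' y.
have guZ := closest_along_geodesic xp gu0 gu1 gui.
have gvZ := closest_along_geodesic yp' gv0 gv1 gvi.
set l := mdist p x in gu1 gui guZ; set l' := mdist p' y in gv1 gvi gvZ.
have lE : dist_set x Z = l by rewrite -dp metric_sym.
have l'0 : 0 <= l' by exact: mdist_ge0.
have l0 : 0 <= l by exact: mdist_ge0.
rewrite lE in xy eP.
pose V := gv @` `[0, l'].
have VE s : 0 <= s -> s <= l' -> V (gv s) by exists s => //=; rewrite in_itv/=; apply/andP.
have V0 : V !=set0 by exists (gv 0); exact: VE.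
have cV : closed V.
  apply: (compact_closed (@metric_hausdorff R X)).
  apply: continuous_compact; last exact: segment_compact.
  exact: isometric_within.
have gl : dist_set (gu l) V <= l / 2.
  by rewrite gu1; apply: le_trans xy; rewrite -gv1; apply: dist_set_le; exact: VE.
have [a [a0 al ea afirst]] := first_half_close l0 V0 gui gl.
have [v Vv dv] := closest_point (gu a) Xproper cV V0.
have [b] := Vv; rewrite /= in_itv/= => /andP[b0 bl'] bv.
rewrite ea in dv.
have [gw [gw0 gw1 gwi]] := geodesic_ex (gu a) v.
rewrite dv in gw1 gwi.
have P0 : 0 < mdist p p' by apply: le_lt_trans eP; rewrite mulr_ge0// ltW.
set P := mdist p p' in eP P0 *.
have uP s : 0 <= s -> s <= a -> mdist p (gu s) = s.
  by move=> s0 sa; rewrite -gu0 gui ?subr0//; lra.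
have vP s : 0 <= s -> s <= l' -> mdist p' (gv s) = s.
  by move=> s0 sa; rewrite -gv0 gvi ?subr0.
have vv t : 0 <= t -> t <= b -> mdist v (gv t) = b - t.
  by move=> t0 tb; rewrite -bv metric_sym gvi.
have ba : b <= 3 / 2 * a.
  have := gvZ b p b0 bl' Zp; rewrite bv.
  have := metric_triangle v (gu a) p.
  by rewrite (metric_sym v (gu a)) dv (metric_sym (gu a) p) uP// (metric_sym v p); lra.
have Pa : P <= 3 * a.
  have := metric_triangle p (gu a) p'; have := metric_triangle (gu a) v p'.
  by rewrite dv uP// -bv (metric_sym (gv b)) vP// -/P; lra.
have a_gt0 : 0 < a by lra.
have aP : e * a <= P by have : e * a <= e * l; [rewrite ler_pM2l|lra].
have UV s t : 0 <= s -> s <= a -> 0 <= t -> t <= b -> P <= 6 * mdist (gu s) (gv t).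
  move=> s0 sa t0 tb; have tl' : t <= l' by lra.
  have H1 := afirst s s0 sa; have H2 := dist_set_le (gu s) (VE t t0 tl').
  have := gvZ t p t0 tl' Zp; have := metric_triangle p (gv t) p'.
  rewrite (metric_sym (gv t) p') vP// -/P (metric_sym (gv t) p).
  by have := metric_triangle p (gu s) (gv t); rewrite uP//; lra.
have wu s : 0 <= s -> s <= a / 2 -> mdist (gu a) (gw s) = s.
  by move=> s0 sa; rewrite -gw0 gwi ?subr0.
have wv s : 0 <= s -> s <= a / 2 -> mdist (gw s) v = a / 2 - s.
  by move=> s0 sa; rewrite -gw1 gwi.
have UW s t : 0 <= s -> s <= a -> 0 <= t -> t <= a / 2 ->
    a - s + t <= 7 * mdist (gu s) (gw t).
  move=> s0 sa t0 ta.
  have H1 := afirst s s0 sa; have := dist_set_le (gu s) Vv.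
  have := metric_triangle (gu s) (gw t) v; rewrite wv//.
  have := metric_triangle (gu s) (gw t) (gu a).
  by rewrite (metric_sym (gw t)) wu// gui//; lra.
have WV s t : 0 <= s -> s <= a / 2 -> 0 <= t -> t <= b ->
    a / 2 - s + (b - t) <= 3 * mdist (gw s) (gv t).
  move=> s0 sa t0 tb; have tl' : t <= l' by lra.
  have := dist_set_le (gu a) (VE t t0 tl'); rewrite ea.
  have := metric_triangle (gu a) (gw s) (gv t); rewrite wu//.
  have := metric_triangle (gv t) (gw s) (gv b); rewrite gvi// bv wv// (metric_sym (gv t)); lra.
have WZ s z : 0 <= s -> s <= a / 2 -> Z z -> a / 2 <= mdist (gw s) z.
  move=> s0 sa Zz; have := guZ a z a0 al Zz.
  by have := metric_triangle (gu a) (gw s) z; rewrite wu//; lra.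
pose L := a + a / 2 + b.
have LP : L <= 3 / e * P.
  by rewrite mulrAC ler_pdivlMr// /L; nra.
have k1 : 18 <= 18 / e by rewrite ler_pdivlMr//; lra.
have kN D N c : 0 <= D -> c <= 18 -> N <= c * D -> N <= 18 / e * D.
  move=> D0 c18 /le_trans; apply; rewrite ler_wpM2r//; exact: le_trans k1.
have gvZ' s z : 0 <= s -> s <= b -> Z z -> s <= mdist (gv s) z.
  by move=> s0 sb; apply: gvZ => //; exact: le_trans bl'.
have guZ' s z : 0 <= s -> s <= a -> Z z -> s <= mdist (gu s) z.
  by move=> s0 sb; apply: guZ => //; exact: le_trans al.
have gui' : isometric_path a gu.
  by move=> s t s0 st ta; apply: gui => //; exact: le_trans al.
have gvi' : isometric_path b (fun t => gv (b - t)).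
  move=> s t s0 st tb; rewrite metric_sym gvi; [ring|..]; clear -s0 st tb bl'; lra.
have WV' s t : 0 <= s -> s <= a / 2 -> 0 <= t -> t <= b ->
    a / 2 - s + t <= 3 * mdist (gw s) (gv (b - t)).
  move=> s0 sa t0 tb; have := WV s (b - t) s0 sa.
  rewrite (_ : b - (b - t) = t); last by ring.
  by apply; clear -t0 tb; lra.
have UV' s t : 0 <= s -> s <= a -> 0 <= t -> t <= b ->
    L <= 18 / e * mdist (gu s) (gv (b - t)).
  move=> s0 sa t0 tb; apply: (le_trans LP).
  rewrite (_ : 18 / e * _ = 3 / e * (6 * mdist (gu s) (gv (b - t)))); last by ring.
  by rewrite ler_pM2l ?divr_gt0//; apply: UV => //; clear -t0 tb; lra.
have [||||||||| |||G [Gk GU GW GV]] :=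
  three_sides_path (k := 18 / e) (a := a) (w := a / 2) (b := b) (gu := gu) (gw := gw)
    (gv := fun t => gv (b - t)).
- by apply: le_trans k1; lra.
- by [].
- by clear -a0; lra.
- by [].
- by rewrite gw0.
- by rewrite gw1 subr0 bv.
- by [].
- by [].
- by [].
- by move=> s t s0 sa t0 ta; apply: (kN _ _ 7); [exact: mdist_ge0|lra|exact: UW].
- by move=> s t s0 sa t0 tb; apply: (kN _ _ 3); [exact: mdist_ge0|lra|exact: WV'].
- exact: UV'.
exists L, G; split.
- by clear -a0 b0; rewrite /L; lra.
- by rewrite GU.
- by rewrite /L GV// subrr.
split=> //.
- move=> s z s0 sL Zz.
  have [sa|sa] := leP s a.
    by left; rewrite GU//; have := guZ' s z s0 sa Zz; have := mdist_ge0 (gu s) z; clear; lra.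
  have [sa'|sa'] := leP s (a + a / 2).
    left; rewrite (_ : s = a + (s - a)); last by ring.
    have s1 : 0 <= s - a by clear -sa; lra.
    have s2 : s - a <= a / 2 by clear -sa'; lra.
    by rewrite GW//; have := WZ (s - a) z s1 s2 Zz; clear -sa'; lra.
  right; rewrite {1}/L (_ : s = a + a / 2 + (s - a - a / 2)); last by ring.
  have s1 : 0 <= s - a - a / 2 by clear -sa'; lra.
  have s2 : 0 <= b - (s - a - a / 2) by move: sL; rewrite /L; clear; lra.
  have s3 : b - (s - a - a / 2) <= b by clear -s1; lra.
  rewrite GV//; have := gvZ' _ z s2 s3 Zz.
  by have := mdist_ge0 (gv (b - (s - a - a / 2))) z; clear; lra.
exists a; first by rewrite a0 /L; clear -a0 b0; lra.
rewrite GU//; apply: (le_trans Pa); rewrite ler_pM2l//.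
by apply: dist_set_ge => // z; exact: guZ'.
Qed.

End Hinge.


(** * Morse rays are contracting *)

Section MorseContracting.
Context {R : realType} {X : metricType R} (o : X).
Context (Xproper : @proper_space R X) (Xgeodesic : @geodesic_space R X).
Context (q Q : R) (alpha : R -> X) (m : R -> R -> R).
Context (aq : quasi_geodesic_ray o q Q alpha) (mm : morse_gauge o m (ray_image alpha)).
Let Z := ray_image alpha.

(** When [d(p, p') > e d(x, Z)], the path of [hinge_path] can be inserted in [alpha],
    run backwards if [p'] comes before [p]. The Morse property confines the resulting
    ray to a neighbourhood of [Z] that depends on [e] only, and the path rises to height at
    least [d(p, p') / 3]. *)
Lemma hinge_bound (e : R) : 0 < e -> e <= 1 -> exists2 C, 0 <= C &
  forall x y p p', closest_proj Z x p -> closest_proj Z y p' ->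
  mdist x y <= dist_set x Z / 2 -> mdist p p' <= e * dist_set x Z + C.
Proof.
move=> e0 e1; pose K := 18 / e.
have K1 : 1 <= K by rewrite ler_pdivlMr//; lra.
pose M := m (4 * q * (1 + K * q)) (q * Q * (1 + K * q) + K * Q).
exists (3 * Num.max 0 M); first by rewrite mulr_ge0// le_max lexx.
move=> x y p p' xp yp' xy.
have M0 : 0 <= Num.max 0 M by rewrite le_max lexx.
have MM : M <= Num.max 0 M by rewrite le_max lexx orbT.
have [|eP] := leP (mdist p p') (e * dist_set x Z); first by lra.
have [L [G [L0 G0 GL [GK Gaway [x0 /andP[x00 x0L] Px0]]]]] :=
  hinge_path Xproper Xgeodesic e0 e1 xp yp' xy eP.
have r0 : 0 <= e * dist_set x Z.
  by rewrite mulr_ge0//; [exact: ltW|apply: dist_set_ge0; exact: ray_image0].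
suff : dist_set (G x0) Z <= M by lra.
have [[Zp _] [Zp' _]] := (xp, yp').
have [s + sp] := Zp; rewrite /= in_itv/= andbT => s0.
have [t + tp] := Zp'; rewrite /= in_itv/= andbT => t0.
have [st|/ltW ts] := leP s t.
  have [||b [bq bG bC]] := detour_ray aq s0 st L0 K1 _ _ GK Gaway.
  - by rewrite G0 sp.
  - by rewrite GL tp.
  have [u u0 <-] := bG x0 x00 x0L.
  exact: (morse_absorbs mm bq bC).
pose G' s := G (L - s).
have [||||b [bq bG bC]] := @detour_ray _ _ o q Q K alpha t s G' L aq t0 ts L0 K1.
- by rewrite /G' subr0 GL tp.
- by rewrite /G' subrr G0 sp.
- move=> u v u0 uv vL; rewrite /G' metric_sym.
  have := GK (L - v) (L - u) ltac:(lra) ltac:(lra) ltac:(lra).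
  by rewrite (_ : L - u - (L - v) = v - u)//; ring.
- move=> u z u0 uL Zz; rewrite /G'.
  have := Gaway (L - u) z ltac:(lra) ltac:(lra) Zz.
  by rewrite (_ : L - (L - u) = u); [case; [right|left]|ring].
have [u u0] := bG (L - x0) ltac:(lra) ltac:(lra).
rewrite /G' (_ : L - (L - x0) = x0); last by ring.
by move=> <-; exact: (morse_absorbs mm bq bC).
Qed.

(** The hypothesis [d(x, y) <= d(x, Z) / 2] is weakened to [d(x, y) <= d(x, Z)] by
    walking from [x] to [y] in steps of length [h]. Both [d(z, y) <= d(z, Z)] and the bound [B] on
    [d(z, Z) + d(z, y)] persist along the walk, which stops at the latest when it comes within [2 h]
    of [Z]: the projections of [z] and [y] are then at distance at most [8 h]. *)
Lemma chain_bound (e C h B : R) : 0 < e -> 0 < h -> 0 <= C ->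
  (forall x y p p', closest_proj Z x p -> closest_proj Z y p' ->
     mdist x y <= dist_set x Z / 2 -> mdist p p' <= e * dist_set x Z + C) ->
  forall n x y p p', closest_proj Z x p -> closest_proj Z y p' ->
  mdist x y <= dist_set x Z -> dist_set x Z + mdist x y <= B ->
  mdist x y <= n%:R * h ->
  mdist p p' <= (n%:R + 1) * (e * B + C) + 8 * h.
Proof.
move=> e0 h0 C0 H; elim=> [|n IH] x y p p' xp yp' xy xyB nh.
all: have Z0 : Z !=set0 by exact: ray_image0.
all: have D0 := mdist_ge0 x y; have dx0 := dist_set_ge0 x Z0.
all: have eB : e * dist_set x Z <= e * B by rewrite ler_pM2l//; lra.
all: have eB0 : 0 <= e * dist_set x Z by rewrite mulr_ge0// ltW.
  by rewrite mul0r in nh; have := H x y p p' xp yp' ltac:(lra); lra.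
rewrite -natr1 in nh *.
have n0 : 0 <= n%:R :> R by exact: ler0n.
have nE : 0 <= n%:R * (e * B + C) by rewrite mulr_ge0//; lra.
have [small|big] := leP (dist_set x Z) (2 * h).
  have [[_ dxp] [_ dyp]] := (xp, yp').
  have := metric_triangle p x p'; have := metric_triangle x y p'.
  rewrite (metric_sym p x) dxp dyp.
  have := dist_set_tri y x Z0; rewrite (metric_sym y x).
  by move=> *; lra.
have [half|nhalf] := leP (mdist x y) (dist_set x Z / 2).
  by have := H x y p p' xp yp' half; lra.
have [g [g0 g1 gi]] := geodesic_ex Xgeodesic x y.
pose z := g h.
have hd : h <= mdist x y by lra.
have xz : mdist x z = h by rewrite -{1}g0 gi ?subr0//; exact: ltW.
have zy : mdist z y = mdist x y - h by rewrite -{1}g1 gi//; exact: ltW.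
have [cZ _ _ _] := mm.
have [pz Zpz dpz] := closest_point z Xproper cZ Z0.
have zpz : closest_proj Z z pz by split.
have xzZ := dist_set_tri x z Z0; have zxZ := dist_set_tri z x Z0.
rewrite (metric_sym z x) in zxZ; rewrite xz in xzZ zxZ.
have H1 := H x z p pz xp zpz ltac:(rewrite xz; lra).
have H2 := IH z y pz p' zpz yp' ltac:(rewrite zy; lra) ltac:(rewrite zy; lra)
  ltac:(rewrite zy; lra).
by have := metric_triangle p pz p'; lra.
Qed.

(** The step [d(x, Z) / n] with [n >= 16 / e] makes the error of the stopping rule at
    most half of [e d(x, Z)]; the slope [e'] is small enough for [n + 1] steps to add up to the
    other half. *)
Lemma morse_projection_bound (e : R) : 0 < e -> exists2 C, 0 <= C &
  forall x y p p', closest_proj Z x p -> closest_proj Z y p' ->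
  mdist x y <= dist_set x Z -> mdist p p' <= e * dist_set x Z + C.
Proof.
move=> e0; pose n := (Num.truncn (16 / e)).+1.
have n0 : 0 < n%:R :> R by rewrite ltr0n.
have ne : 16 <= e * n%:R.
  by rewrite mulrC -ler_pdivrMr//; apply: ltW; exact: truncnS_gt.
pose e' := Num.min 1 (e / (4 * (n%:R + 1))).
have n1 : 0 < 4 * (n%:R + 1) :> R by lra.
have e'0 : 0 < e' by rewrite lt_min ltr01 divr_gt0.
have e'1 : e' <= 1 by rewrite ge_min lexx.
have e'e : e' * (4 * (n%:R + 1)) <= e.
  by rewrite -ler_pdivlMr// ge_min lexx orbT.
have [C C0 HC] := hinge_bound e'0 e'1.
exists ((n%:R + 1) * C); first by rewrite mulr_ge0//; lra.
move=> x y p p' xp yp' xy.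
have Z0 : Z !=set0 by exact: ray_image0.
have := dist_set_ge0 x Z0; rewrite le_eqVlt => /predU1P[r0|r0].
  have := HC x y p p' xp yp'; rewrite -r0 in xy *.
  move=> /(_ ltac:(lra)).
  have : 0 <= n%:R * C by rewrite mulr_ge0// ltW.
  lra.
set r := dist_set x Z in xy r0 *.
have h0 : 0 < r / n%:R by rewrite divr_gt0.
have := @chain_bound e' C (r / n%:R) (2 * r) e'0 h0 C0 HC n x y p p' xp yp' xy.
move=> /(_ ltac:(rewrite -/r; lra)); rewrite mulrC divfK ?gt_eqF// => /(_ xy).
have : 8 * (r / n%:R) <= e / 2 * r.
  by rewrite mulrA ler_pdivrMr//; nra.
have : (n%:R + 1) * (e' * (2 * r)) <= e / 2 * r by nra.
lra.
Qed.

(** Affine bounds of arbitrarily small slope on the diameter of projections give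
    a sublinear contraction function. *)
Lemma morse_contracting : contracting Z.
Proof.
have Z0 : Z !=set0 by exact: ray_image0.
pose A e C := forall x y p p', mdist x y <= dist_set x Z ->
  (closest_proj Z x `|` closest_proj Z y) p ->
  (closest_proj Z x `|` closest_proj Z y) p' ->
  mdist p p' <= e * dist_set x Z + C.
have Aex e : 0 < e -> exists2 C, 0 <= C & A e C.
  move=> e0; have e2 : 0 < e / 2 by lra.
  have [C C0 HC] := morse_projection_bound e2; exists C => // x y p p' xy.
  have dx0 : 0 <= e * dist_set x Z by rewrite mulr_ge0 ?dist_set_ge0// ltW.
  have dyx := dist_set_tri y x Z0; rewrite (metric_sym y x) in dyx.
  have edy : e * dist_set y Z <= e * (2 * dist_set x Z) by rewrite ler_pM2l//; lra.
  have same z w v : closest_proj Z z w -> closest_proj Z z v ->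
      mdist w v <= e / 2 * dist_set z Z + C.
    by move=> zw zv; apply: HC zw zv _; rewrite mdistxx dist_set_ge0.
  move=> [xp|yp] [xp'|yp'].
  - by have := same _ _ _ xp xp'; lra.
  - by have := HC _ _ _ _ xp yp' xy; lra.
  - by have := HC _ _ _ _ xp' yp xy; rewrite metric_sym; lra.
  - by have := same _ _ _ yp yp'; lra.
have [rho srho rhoP] := affine_bounds_sublinear Aex.
have [cZ _ _ _] := mm.
exists rho; split=> // x y xy; apply: ge_ereal_sup => _ [[p p'] /= [Hp Hp'] <-].
rewrite lee_fin; apply: rhoP; first exact: dist_set_ge0.
by move=> e C _ _ AeC; exact: AeC xy Hp Hp'.
Qed.

End MorseContracting.

(** * Points of equal norm on a contracting ray *)

Section NormGap.
Context {R : realType} {X : metricType R} (o : X).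
Context (Xproper : @proper_space R X) (Xgeodesic : @geodesic_space R X).

(** A geodesic is a [(1, 0)]-quasi-geodesic, and an excursion that lasts until the
    endpoint [y] of [Z] has length at most [2 kappa]. *)
Lemma geodesic_near_contracting (rho : R -> R) Z x y (g : R -> X) :
  contracting_with rho Z -> Z x -> Z y -> g 0 = x -> g (mdist x y) = y ->
  isometric_path (mdist x y) g ->
  forall u, 0 <= u -> u <= mdist x y -> dist_set (g u) Z <= 6 * kappa rho 1 0.
Proof.
move=> crho Zx Zy g0 g1 gi u u0 ul; set l := mdist x y in g1 gi ul *.
have gq : quasi_path 1 0 0 l g.
  split=> //; first exact: isometric_within.
  by move=> s t s0 st tl; rewrite gi//; split; lra.
have Z0 : Z !=set0 by exists x.
have k3 := @kappa_ge3 R rho 1 0 (lexx _).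
have Zg0 : Z (g 0) by rewrite g0.
have [near|[s [s0 su _ ls]]] := excursion Xproper crho Z0 gq Zg0 u0 ul.
  by apply: (le_trans near); lra.
rewrite g1 dist_set0// in ls.
by have := dist_set_le (g u) Zy; rewrite -g1 gi//; lra.
Qed.

(** The point [alpha t1] is uniformly close to the geodesic from [o] to [alpha t2], along
    which norms and distances add up. To see it, take a point of this geodesic which is
    equally far from the parts of [alpha] before and after [t1]. Being close to [alpha],
    it is close to both parts, so the times of the two nearby points of [alpha] are
    close to each other and [t1] is between them. *)
Lemma contracting_norm_gap q Q (rho : R -> R) (alpha : R -> X) :
  quasi_geodesic_ray o q Q alpha -> contracting_with rho (ray_image alpha) ->
  exists M, forall t1 t2, 0 <= t1 -> t1 <= t2 ->
    mdist o (alpha t1) + mdist (alpha t1) (alpha t2) <= mdist o (alpha t2) + M.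
Proof.
move=> aq crho; have [q1 Q0 a0 _ _] := aq.
pose c := 6 * kappa rho 1 0 + 1.
have k3 := @kappa_ge3 R rho 1 0 (lexx _).
exists (2 * (c + (q * (q * (2 * c + Q)) + Q))) => t1 t2 t10 t12.
have [g [g0 g1 gi]] := geodesic_ex Xgeodesic o (alpha t2).
set l := mdist o (alpha t2) in g1 gi *.
have l0 : 0 <= l by exact: mdist_ge0.
have t20 : 0 <= t2 by lra.
pose A := alpha @` `[0, t1]; pose B := alpha @` `[t1, +oo[.
have A0 : A !=set0 by exists (alpha 0), 0 => //=; rewrite in_itv/= lexx.
have B0 : B !=set0 by exists (alpha t2), t2 => //=; rewrite in_itv/= t12.
have [|||w [w0 wl hw]] :=
  @ivt_le R (fun u => dist_set (g u) A - dist_set (g u) B) 0 l 0 l0.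
- apply: (@lipschitz_real_within _ _ _ 2) => // s t.
  rewrite /= !in_itv/= => /andP[s0 _] /andP[_ tl] st.
  have := dist_set_tri (g s) (g t) A0; have := dist_set_tri (g t) (g s) A0.
  have := dist_set_tri (g s) (g t) B0; have := dist_set_tri (g t) (g s) B0.
  rewrite !(metric_sym (g t)) (gi s t s0 st tl) => ? ? ? ?.
  by rewrite ler_norml; apply/andP; split; lra.
- rewrite g0 (@dist_set0 _ _ o A); last by exists 0 => //=; rewrite in_itv/= lexx.
  by rewrite sub0r oppr_le0; exact: dist_set_ge0.
- rewrite g1 (@dist_set0 _ _ _ B); last by exists t2 => //=; rewrite in_itv/= t12.
  by rewrite subr0; exact: dist_set_ge0.
have wZ := geodesic_near_contracting crho (ray_image_origin aq)
  (ray_imageP alpha t20) g0 g1 gi w0 wl.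
have [z [t + tz] dz] := dist_set_approx (g w) (ray_image0 alpha) (@ltr01 R).
rewrite /= in_itv/= andbT => tge0.
have ABw : dist_set (g w) A < c /\ dist_set (g w) B < c.
  have zc : mdist (g w) z < c by rewrite /c; lra.
  have [tt1|tt1] := leP t t1.
    have : dist_set (g w) A <= mdist (g w) z.
      by apply: dist_set_le; exists t => //=; rewrite in_itv/= tge0.
    by split; lra.
  have : dist_set (g w) B <= mdist (g w) z.
    by apply: dist_set_le; exists t => //=; rewrite in_itv/= ltW.
  by split; lra.
have [Aw Bw] := ABw.
have Ac : 0 < c - dist_set (g w) A by lra.
have Bc : 0 < c - dist_set (g w) B by lra.
have [_ [v + <-] dv] := dist_set_approx (g w) A0 Ac.
have [_ [v' + <-] dv'] := dist_set_approx (g w) B0 Bc.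
rewrite /= !in_itv/= andbT => t1v' /andP[v0 vt1].
have aE x y : 0 <= x -> x <= y -> y - x <= q * (mdist (alpha x) (alpha y) + Q) /\
    mdist (alpha x) (alpha y) <= q * (y - x) + Q.
  move=> x0 xy; have [_ _ _ H] := ray_path aq (le_trans x0 xy); exact: H.
have [vv _] := aE v v' v0 ltac:(lra).
have [_ vt] := aE v t1 v0 vt1.
have dvv : mdist (alpha v) (alpha v') <= 2 * c.
  by have := metric_triangle (alpha v) (g w) (alpha v'); rewrite (metric_sym (alpha v) (g w)); lra.
have H1 : t1 - v <= q * (2 * c + Q).
  have : q * (mdist (alpha v) (alpha v') + Q) <= q * (2 * c + Q).
    by rewrite ler_pM2l ?lerD2r//; lra.
  lra.
have H2 : q * (t1 - v) <= q * (q * (2 * c + Q)) by rewrite ler_pM2l//; lra.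
have near : mdist (g w) (alpha t1) <= c + (q * (q * (2 * c + Q)) + Q).
  by have := metric_triangle (g w) (alpha v) (alpha t1); lra.
have ow : mdist o (g w) = w by rewrite -g0 gi ?subr0.
have wl' : mdist (g w) (alpha t2) = l - w by rewrite -g1 gi.
have := metric_triangle o (g w) (alpha t1); have := metric_triangle (alpha t1) (g w) (alpha t2).
by rewrite ow wl' (metric_sym _ (g w)); lra.
Qed.

End NormGap.

(** * The two boundaries as sets *)

Section Equivalences.
Context {R : realType} {X : metricType R} (o : X).
Context (Xproper : @proper_space R X) (Xgeodesic : @geodesic_space R X).
Implicit Types (alpha beta : R -> X).

Lemma morse_rayP alpha : morse_ray o alpha <-> contracting_ray o alpha.
Proof.
split=> [[[q [Q aq]] [m mm]]|[[q [Q aq]] [rho crho]]]; split.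
- by exists q, Q.
- exact: (morse_contracting Xproper Xgeodesic aq mm).
- by exists q, Q.
- exists (contracting_gauge rho).
  exact: (contracting_morse Xproper crho (ray_image_origin aq)).
Qed.

(** The summand 1 accounts for distances to sets that need not be attained. *)
Lemma closed_nbhd_trans (Z1 Z2 : set X) (C1 C2 : R) x : Z1 !=set0 -> Z2 !=set0 ->
  dist_set x Z1 <= C1 -> Z1 `<=` closed_nbhd Z2 C2 -> dist_set x Z2 <= C1 + 1 + C2.
Proof.
move=> Z10 Z20 xZ1 Z12; have [z Zz xz] := dist_set_approx x Z10 (@ltr01 R).
have := dist_set_tri x z Z20; have : dist_set z Z2 <= C2 by exact: Z12.
lra.
Qed.

Lemma bounded_hausdorff_sym (A Z : set X) : bounded_hausdorff A Z -> bounded_hausdorff Z A.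
Proof. by move=> [C [? ?]]; exists C. Qed.

Lemma bounded_hausdorff_trans (A B Z : set X) : A !=set0 -> B !=set0 -> Z !=set0 ->
  bounded_hausdorff A B -> bounded_hausdorff B Z -> bounded_hausdorff A Z.
Proof.
move=> A0 B0 Z0 [C [AB BA]] [C' [BZ ZB]]; exists (C + C' + 1); split=> x Hx.
- have := closed_nbhd_trans B0 Z0 (AB x Hx) BZ; rewrite /closed_nbhd/=; lra.
- have := closed_nbhd_trans B0 A0 (ZB x Hx) BA; rewrite /closed_nbhd/=; lra.
Qed.

Lemma morse_equivP alpha beta : morse_equiv o alpha beta <->
  forall e, 0 < e -> exists2 M, 0 < M & forall r, M <= r ->
    mdist (ray_at o alpha r) (ray_at o beta r) <= e * r.
Proof. by rewrite -ratio_cvg0P// => r _; exact: mdist_ge0. Qed.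

Lemma morse_equiv_sym alpha beta : morse_equiv o alpha beta -> morse_equiv o beta alpha.
Proof.
move=> /morse_equivP H; apply/morse_equivP => e e0; have [M M0 HM] := H e e0.
by exists M => // r Mr; rewrite metric_sym; exact: HM.
Qed.

Lemma morse_equiv_subset alpha beta : contracting_ray o alpha -> contracting_ray o beta ->
  morse_equiv o alpha beta ->
  exists C, ray_image beta `<=` closed_nbhd (ray_image alpha) C.
Proof.
move=> [[q [Q aq]] [rho crho]] [[q' [Q' bq]] _] /morse_equivP close.
exists (contracting_gauge rho q' Q') => _ [t + <-]; rewrite /= in_itv/= andbT => t0.
apply: (sublinear_neighbour Xproper crho (ray_image_origin aq) bq) => // e e0.
have [M M0 HM] := close e e0; exists M => // r Mr.
have [ft0 _ _ _] := first_timeP aq (le_trans (ltW M0) Mr).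
by apply: le_trans (HM r Mr); rewrite metric_sym; apply: dist_set_le; exact: ray_imageP.
Qed.

(** Sublinearly close rays are uniformly close by [sublinear_neighbour]. Conversely, a
    point of [beta] close to the point of [alpha] of norm [r] has norm close to [r], and
    [contracting_norm_gap] puts it close to the point of [beta] at the first time of norm [r]. *)
Lemma morse_equiv_iff_hausdorff alpha beta : contracting_ray o alpha -> contracting_ray o beta ->
  morse_equiv o alpha beta <-> contracting_equiv alpha beta.
Proof.
move=> ca cb; split=> [mab|].
  have [C HC] := morse_equiv_subset ca cb mab.
  have [C' HC'] := morse_equiv_subset cb ca (morse_equiv_sym mab).
  exists (Num.max C C'); split=> x.
    by move=> /HC' /le_trans; apply; rewrite le_max lexx orbT.
  by move=> /HC /le_trans; apply; rewrite le_max lexx.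
move=> [C [aC _]]; have [[q [Q aq]] _] := ca.
have [[q' [Q' bq]] [rho crho]] := cb.
have [M HM] := contracting_norm_gap Xproper Xgeodesic bq crho.
have gap t t' : 0 <= t -> 0 <= t' ->
    mdist (beta t) (beta t') <= `|mdist o (beta t) - mdist o (beta t')| + M.
  move=> t0 t'0; have [tt'|/ltW t't] := leP t t'.
    by have := HM t t' t0 tt'; have := ler_norm (mdist o (beta t') - mdist o (beta t));
      rewrite distrC; lra.
  by have := HM t' t t'0 t't; have := ler_norm (mdist o (beta t) - mdist o (beta t'));
    rewrite (metric_sym (beta t)); lra.
apply/morse_equivP => e e0.
pose c := Num.max 1 (2 * C + 2 + M).
have c1 : 1 <= c by rewrite le_max lexx.
exists (c / e); first by rewrite divr_gt0//; lra.
move=> r cr; have r0 : 0 <= r by apply: le_trans cr; rewrite divr_ge0//; lra.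
rewrite ler_pdivrMr// in cr; rewrite mulrC; apply: le_trans cr.
rewrite le_max; apply/orP; right.
have [fa0 ea _ _] := first_timeP aq r0; have [fb0 eb _ _] := first_timeP bq r0.
have [z [t + tz] dz] := dist_set_approx (ray_at o alpha r) (ray_image0 beta) (@ltr01 R).
rewrite /= in_itv/= andbT => t0; rewrite -tz in dz.
have dC : dist_set (ray_at o alpha r) (ray_image beta) <= C by apply/aC/ray_imageP.
have G := gap t (first_time o beta r) t0 fb0.
rewrite -/(ray_at o beta r) eb in G.
have N : `|mdist o (beta t) - r| <= C + 1.
  have := metric_triangle o (ray_at o alpha r) (beta t).
  have := metric_triangle o (beta t) (ray_at o alpha r).
  rewrite ea (metric_sym (beta t) (ray_at _ _ _)) => ? ?.
  by rewrite ler_norml; apply/andP; split; lra.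
by have := metric_triangle (ray_at o alpha r) (beta t) (ray_at o beta r); lra.
Qed.

Lemma boundary_eq : morse_boundary o = contracting_boundary o.
Proof.
have E : morse_ray o = contracting_ray o.
  by apply/funext => alpha; apply/propext; exact: morse_rayP.
rewrite /morse_boundary /contracting_boundary E.
apply: eq_imagel => alpha ca; apply/seteqP.
by split=> beta [cb] /(morse_equiv_iff_hausdorff ca cb).
Qed.

Lemma boundary_members b alpha beta : contracting_boundary o b -> b alpha -> b beta ->
  bounded_hausdorff (ray_image alpha) (ray_image beta).
Proof.
move=> [a0 _ <-] [_ H1] [_ H2].
apply: bounded_hausdorff_trans (bounded_hausdorff_sym H1) H2; exact: ray_image0.
Qed.

End Equivalences.

(** * The two topologies *)

Section Topologies.
Context {R : realType} {X : metricType R} (o : X).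
Context (Xproper : @proper_space R X) (Xgeodesic : @geodesic_space R X).
Implicit Types (alpha : R -> X) (q Q r : R).

Lemma quasi_geodesic_ray_mono q Q q' Q' alpha : q <= q' -> Q <= Q' ->
  quasi_geodesic_ray o q Q alpha -> quasi_geodesic_ray o q' Q' alpha.
Proof.
move=> qq QQ [q1 Q0 a0 ca H]; split=> //; [lra|lra|].
move=> s t s0 t0; have /andP[lo up] := H s t s0 t0; apply/andP.
have n0 : 0 <= `|s - t| by [].
have : q'^-1 * `|s - t| <= q^-1 * `|s - t| by rewrite ler_wpM2r// lef_pV2// posrE; lra.
have : q * `|s - t| <= q' * `|s - t| by rewrite ler_wpM2r.
by split; lra.
Qed.

Lemma dist_sets_le (A Z : set X) x z : A x -> Z z -> dist_sets A Z <= mdist x z.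
Proof.
move=> Ax Zz; apply: ge_inf; last by exists (x, z).
by exists 0 => _ [p _ <-]; exact: mdist_ge0.
Qed.

Lemma dist_sets_approx (A Z : set X) (e : R) : A !=set0 -> Z !=set0 -> 0 < e ->
  exists x z, [/\ A x, Z z & mdist x z < dist_sets A Z + e].
Proof.
move=> [x Ax] [z Zz] e0.
have [||_ [[x' z'] [/= Ax' Zz'] <-] H] :=
  @inf_adherent R [set mdist p.1 p.2 | p in A `*` Z] e => //.
  split; first by exists (mdist x z), (x, z).
  by exists 0 => _ [p _ <-]; exact: mdist_ge0.
by exists x', z'.
Qed.

(** The moment after which an excursion away from [Z] may begin: a ray that
    is near [Z] at time [T] was within [kappa] of [Z] at a not much earlier time. *)
Lemma last_near_time (rho : R -> R) (Z : set X) q Q alpha T :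
  contracting_with rho Z -> Z o -> quasi_geodesic_ray o q Q alpha -> 0 <= T ->
  exists t, [/\ 0 <= t, t <= T, dist_set (alpha t) Z <= kappa rho q Q &
    T - t <= 2 * q * (kappa rho q Q + 3 / 2 * dist_set (alpha T) Z + Q)].
Proof.
move=> crho Zo aq T0; have Z0 : Z !=set0 by exists o.
have [q1 Q0 a0 _ _] := aq; have k3 := kappa_ge3 rho Q q1.
have DT := dist_set_ge0 (alpha T) Z0.
have [near|far] := leP (dist_set (alpha T) Z) (kappa rho q Q).
  by exists T; split=> //; rewrite subrr !mulr_ge0//; lra.
have [_ _ ca _] := ray_path aq T0.
have [|t [t0 tT et H]] := last_crossing T0 (dist_set_within Z0 ca) _ (ltW far).
  by rewrite a0 dist_set0//; lra.
exists t; split=> //; first by rewrite et.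
rewrite -{1}et; apply: (far_time_bound Xproper crho Z0 _ tT H).
exact: sub_quasi_path (ray_path aq T0) _ _.
Qed.

Lemma geodesic_ray_norm (g : R -> X) r : geodesic_ray o g -> 0 <= r -> mdist o (g r) = r.
Proof.
move=> [g0 gi] r0; rewrite -{1}g0 gi ?in_itv/= ?lexx ?r0//.
by rewrite sub0r normrN ger0_norm.
Qed.

Section FixedPoint.
Context (gam1 : set (R -> X) -> R -> X) (mu : set (R -> X) -> R -> R -> R)
        (gam : set (R -> X) -> R -> X) (rho : set (R -> X) -> R -> R).
Context (b : set (R -> X)) (bB : contracting_boundary o b).
Context (ggeo : geodesic_ray o (gam b)) (bgam : b (gam b))
        (grho : contracting_with (rho b) (ray_image (gam b))).
Context (bgam1 : b (gam1 b)) (gmu : morse_gauge o (mu b) (ray_image (gam1 b))).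

Let go : ray_image (gam b) o.
Proof. by have [g0 _] := ggeo; rewrite -g0; exact: ray_imageP. Qed.

(** If [kappa >= r] the point of [gam b] of norm [r] is close enough to the origin.
    Otherwise [q] and [Q] are less than [r]. The gauge may be unbounded on this bounded
    range of constants, so [alpha] is viewed as a quasi-geodesic with the single pair of
    constants [(1 + r, r)]: for [r'] large it is then close to [gam b] at radius [r']. The last
    point of [alpha] within [kappa] of [gam b] comes at a bounded time before, so it and its
    projection to [gam b] have norm at least [r]. *)
Lemma U_morse_small r : 0 < r -> exists2 r', 0 < r' &
  U_morse o gam1 mu b r' `<=` U_contracting o gam rho b r.
Proof.
move=> r0.
have [H [HH _]] := boundary_members bB bgam1 bgam.
pose q1 := 1 + r; pose m1 := mu b q1 r; pose M1 := Num.max 0 (m1 + 1 + H).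
have M10 : 0 <= M1 by rewrite le_max lexx.
pose r' := Num.max (2 * m1) (3 * r + 2 * q1 ^+ 2 * (2 * r + 3 / 2 * M1) + 1).
have r'1 : 2 * m1 <= r' by rewrite le_max lexx.
have r'2 : 3 * r + 2 * q1 ^+ 2 * (2 * r + 3 / 2 * M1) + 1 <= r'.
  by rewrite le_max lexx orbT.
have q12 : 0 <= q1 ^+ 2 by rewrite sqr_ge0.
have r'0 : 0 < r'.
  have : 0 <= 2 * q1 ^+ 2 * (2 * r + 3 / 2 * M1) by rewrite mulr_ge0//; lra.
  lra.
exists r' => // a [aB aU]; split; first by rewrite -boundary_eq.
move=> q Q alpha aalpha aq; set k := kappa (rho b) q Q.
have [q1' Q0 _ _ _] := aq.
have [kQ kq] := kappa_ge (rho b) q Q.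
have [kr|rk] := leP r k.
  apply: le_trans kr; rewrite -{2}(geodesic_ray_norm ggeo (ltW r0)).
  apply: dist_sets_le; first exact: ray_image_origin aq.
  split; first by apply: ray_imageP; exact: ltW.
  by rewrite /= geodesic_ray_norm//; exact: ltW.
have k3 : 3 <= k by exact: kappa_ge3.
have qq : q <= q ^+ 2 by rewrite ler_eXnr.
rewrite -/k in kQ kq.
have aq1 : quasi_geodesic_ray o q1 r alpha.
  by apply: quasi_geodesic_ray_mono aq; rewrite /q1; lra.
have [T0 eT _ _] := first_timeP aq1 (ltW r'0).
set T := first_time o alpha r' in T0 eT.
have nearT : dist_set (alpha T) (ray_image (gam b)) <= M1.
  rewrite le_max; apply/orP; right.
  apply: (@closed_nbhd_trans _ _ (ray_image (gam1 b))); try exact: ray_image0.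
  - apply: (aU q1 r alpha aalpha aq1); first by rewrite -/m1; lra.
    by exists T => //=; rewrite in_itv/= T0 lexx.
  - exact: HH.
have [t [t0 tT tk tlen]] := last_near_time grho go aq T0.
rewrite -/k in tk tlen.
have [cZ _ _] := grho.
have [p Zp dp] := closest_point (alpha t) Xproper cZ (ray_image0 (gam b)).
have [pr|pr] := leP r (mdist o p).
  apply: le_trans tk; rewrite -dp; apply: dist_sets_le; [exact: ray_imageP|by []].
exfalso.
have [_ _ _ /(_ t T t0 tT (lexx _))[_ up]] := ray_path aq T0.
have := metric_triangle o p (alpha T); have := metric_triangle p (alpha t) (alpha T).
rewrite (metric_sym p (alpha t)) dp -/(ray_at o alpha r') eT.
have q2 : q ^+ 2 <= q1 ^+ 2 by rewrite lerXn2r// ?nnegrE /q1; lra.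
have : q * (T - t) <= 2 * q ^+ 2 * (k + 3 / 2 * M1 + Q).
  rewrite (_ : 2 * q ^+ 2 * (k + 3 / 2 * M1 + Q) = q * (2 * q * (k + 3 / 2 * M1 + Q))); last by ring.
  rewrite ler_pM2l; last by lra.
  apply: (le_trans tlen); rewrite ler_pM2l; lra.
have : q ^+ 2 * (k + 3 / 2 * M1 + Q) <= q1 ^+ 2 * (2 * r + 3 / 2 * M1).
  by apply: ler_pM; rewrite ?sqr_ge0//; lra.
rewrite /ray_at -/T; lra.
Qed.

(** The condition [m q Q <= r / 2] makes [q] and [Q] less than [r], so [alpha] is a
    [(1 + r, r)]-quasi-geodesic and comes within a known distance of [gam b] beyond radius
    [r']. Up to then it stays at a distance at most [C] of [gam1 b], where [C] depends on [r]
    only. The Morse property for the constant function [C] gives a radius [S] at which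
    this is enough, and any [r'] sufficiently beyond [S] will do. *)
Lemma U_contracting_small r : 0 < r -> exists2 r', 0 < r' &
  U_contracting o gam rho b r' `<=` U_morse o gam1 mu b r.
Proof.
move=> r0.
have [H [_ HH]] := boundary_members bB bgam1 bgam.
have [_ _ mge mM] := gmu.
pose q1 := 1 + r; pose k1 := kappa (rho b) q1 r.
have q11 : 1 <= q1 by rewrite /q1; lra.
have k3 : 3 <= k1 by exact: kappa_ge3.
pose W := 2 * q1 * (k1 + 3 / 2 * (k1 + 1) + r).
have W0 : 0 <= q1 * W by rewrite /W !mulr_ge0//; lra.
pose M2 := contracting_gauge (rho b) q1 r + q1 * W + r + k1 + 1.
have g0 : k1 <= contracting_gauge (rho b) q1 r by apply: kappa_le_gauge => //; exact: ltW.
pose C := Num.max 1 (M2 + 1 + H).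
have C1 : 1 <= C by rewrite le_max lexx.
have [S S0 HS] := mM _ r (sublinear_cst C1) r0.
exists (S + k1 + 1); first by lra.
move=> a [aB aU]; split; first by rewrite boundary_eq.
move=> q Q alpha aalpha aq mr.
have [q1' Q0 _ _ _] := aq.
have := mge q Q q1' Q0; rewrite ge_max => /andP[qm Qm].
have mr' : mu b q Q <= r by lra.
have aq1 : quasi_geodesic_ray o q1 r alpha.
  by apply: quasi_geodesic_ray_mono aq; rewrite /q1; lra.
have S'0 : 0 <= S + k1 + 1 by lra.
have far0 : ray_image (gam b) `&` [set p | S + k1 + 1 <= mdist o p] !=set0.
  exists (gam b (S + k1 + 1)); split; first exact: ray_imageP.
  by rewrite /= geodesic_ray_norm.
have [_ [p [[t + <-] [Zp pS] tp]]] :=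
  dist_sets_approx (ray_image0 alpha) far0 (@ltr01 R).
rewrite /= in_itv/= andbT => t0.
have {}tp : mdist (alpha t) p < k1 + 1.
  apply: (lt_le_trans tp); rewrite lerD2r; exact: aU aalpha aq1.
have tZ : dist_set (alpha t) (ray_image (gam b)) <= k1 + 1.
  by apply: le_trans (ltW tp); exact: dist_set_le.
have nS : S <= mdist o (alpha t).
  by have := metric_triangle o (alpha t) p; move: pS => /=; lra.
have [fS0 _ _ fSmin] := first_timeP aq (ltW S0).
have fSt := fSmin t t0 nS.
apply: (HS q Q alpha aq mr).
rewrite le_max; apply/orP; right.
apply: closed_nbhd_trans (ray_image0 (gam b)) (ray_image0 _) _ HH.
have k10 : 0 <= k1 by lra.
rewrite /ray_at; have [near|[s [s0 su _ st]]] :=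
    ray_near_contracting Xproper grho go aq1 fS0 fSt.
  by rewrite /M2; lra.
rewrite -/k1 in st.
have tsW : t - s <= W.
  by apply: (le_trans st); rewrite /W ler_pM2l; lra.
have [_ _ _ /(_ (first_time o alpha S) t fS0 fSt (lexx _))[_ up]] := ray_path aq1 t0.
have : q1 * (t - first_time o alpha S) <= q1 * W by rewrite ler_pM2l; lra.
have := dist_set_tri (alpha (first_time o alpha S)) (alpha t) (ray_image0 (gam b)).
by rewrite /M2; lra.
Qed.

End FixedPoint.

Lemma nbhd_topology_eq {T : Type} (B : set T) (U U' : T -> R -> set T) :
  (forall b, B b -> forall r, 0 < r -> exists2 r', 0 < r' & U b r' `<=` U' b r) ->
  (forall b, B b -> forall r, 0 < r -> exists2 r', 0 < r' & U' b r' `<=` U b r) ->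
  nbhd_topology B U = nbhd_topology B U'.
Proof.
move=> UU' U'U; apply/seteqP; split=> V [VB H]; split=> // b bV.
  have [r r0 rV] := H b bV; have [r' r'0 r'r] := U'U b (VB b bV) r r0.
  by exists r' => //; exact: subset_trans rV.
have [r r0 rV] := H b bV; have [r' r'0 r'r] := UU' b (VB b bV) r r0.
by exists r' => //; exact: subset_trans rV.
Qed.

End Topologies.

Theorem theorem1p1 (R : realType) (X : metricType R) (o : X)
    (Xproper : @proper_space R X) (Xgeodesic : @geodesic_space R X) :
  morse_boundary o = contracting_boundary o /\
  (forall (gam1 : set (R -> X) -> R -> X) (mu : set (R -> X) -> R -> R -> R)
          (gam : set (R -> X) -> R -> X) (rho : set (R -> X) -> R -> R),
     morse_choice o gam1 mu -> contracting_choice o gam rho ->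
     morse_topology o gam1 mu = contracting_topology o gam rho).
Proof.
have E := boundary_eq o Xproper Xgeodesic; split=> // gam1 mu gam rho mc cc.
rewrite /morse_topology /contracting_topology E.
apply: nbhd_topology_eq => b bB r r0;
  have [ggeo bgam grho] := cc b bB; have [] := mc b _; rewrite ?E// => bgam1 gmu.
- exact: U_morse_small.
- exact: U_contracting_small.
Qed.
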